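(* Let $\epsilon \le 1/16$. Consider the $(6,3)$-majority algorithm run by $n$ nodes against a late $\epsilon$-bounded adaptive blocking adversary, starting from any initial assignment of values in $\{0,1\}$ to the nodes in which no node is undefined. Then $O(\log n)$ rounds suffice to ensure that, with high probability, all except a constant fraction of the nodes hold the same value.
   Context: Model: $n$ anonymous nodes, every pair of which can communicate directly, operate in synchronous rounds; in each round every node first receives all messages sent to it in the previous round that were not blocked, then performs arbitrary local computation, then sends messages. A late $\epsilon$-bounded adaptive adversary (with unlimited computational power): at the start of each round $t\ge 2$ it observes the complete state of the system at the beginning of round $t-1$, and based on this chooses a set $B_t$ of at most $\epsilon n$ nodes to block in round $t$; a blocked node can neither send nor receive messages in that round, and a node knows whether it is currently blocked. In round 1 the adversary knows the initial state but not the random choices made by the nodes in that round. ''With high probability'' (w.h.p.) means with probability at least $1-n^{-\Omega(1)}$. The $(k,\ell)$-majority algorithm (integers $k\ge \ell>0$, $\ell$ odd): each node $u$ has a variable $x_u\in\{0,1,\bot\}$; $u$ is undefined if $x_u=\bot$ and defined otherwise. In each round every node $u$ acts as follows. Reset rule: if $u$ received fewer than $\ell$ values from the previous round, or $u$ is blocked, then $u$ sets $x_u:=\bot$ and skips the rest of the round. Update rule: otherwise $u$ picks $\ell$ of the received values uniformly at random, sets $x_u$ to the majority of these $\ell$ values, and sends $x_u$ to $k$ nodes chosen independently and uniformly at random. *)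

(* Defs.v *)
From HB Require Import structures.
From mathcomp Require Import all_boot all_order all_algebra.
From mathcomp Require Import reals exp.
Set Implicit Arguments. Unset Strict Implicit. Unset Printing Implicit Defensive.
Import Order.TTheory GRing.Theory Num.Theory.
Local Open Scope ring_scope.

Section Model.
Variable R : realType.

Definition dist (A : Type) := seq (R * A).
Definition dret (A : Type) (a : A) : dist A := [:: (1, a)].
Definition dbind (A B : Type) (d : dist A) (f : A -> dist B) : dist B :=
  flatten [seq [seq (pw.1 * qy.1, qy.2) | qy <- f pw.2] | pw <- d].
Definition duniform (A : Type) (s : seq A) : dist A :=
  [seq (1 / (size s)%:R, x) | x <- s].
Definition prob (A : Type) (d : dist A) (P : A -> bool) : R :=
  \sum_(pw <- d) (if P pw.2 then pw.1 else 0).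

Fixpoint dseq (A : Type) (l : seq (dist A)) : dist (seq A) :=
  match l with
  | [::] => dret [::]
  | d :: l' => dbind d (fun a => dbind (dseq l') (fun r => dret (a :: r)))
  end.

Definition majority (s : seq bool) : bool := (size s < 2 * count id s)%N.

(** A configuration at the beginning of a round: the variable x_u of each
    node (None = undefined, bottom) and the multiset (as a list) of values
    received by u, i.e. sent to u in the previous round. *)
Definition config (n : nat) : Type := ('I_n -> option bool) * ('I_n -> seq bool).

(** Action of a node in one round of the (k,l)-majority algorithm:
    new value and list of the k targets it sends its value to. *)
Definition node_step (n k l : nat) (blocked : bool) (inbox : seq bool)
  : dist (option bool * seq 'I_n) :=
  if blocked || (size inbox < l)%N then dret (None, [::])
  else dbind (duniform (enum [set S : {set 'I_(size inbox)} | #|S| == l]))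
         (fun S => let v := majority [seq nth false inbox (nat_of_ord i) | i in S] in
            dbind (duniform (enum {: k.-tuple 'I_n}))
              (fun ts => dret (Some v, val ts))).

(** Assemble the next configuration from the per-node outcomes
    (listed in the order of enum 'I_n). Only defined nodes send. *)
Definition assemble (n : nat) (r : seq (option bool * seq 'I_n)) : config n :=
  (fun u : 'I_n => (nth (None, [::]) r u).1,
   fun v => flatten [seq match (nth (None, [::]) r u).1 with
                         | Some b => [seq b | t <- (nth (None, [::]) r u).2 & t == v]
                         | None => [::]
                         end | u : 'I_n <- enum 'I_n]).

Definition round (n k l : nat) (B : {set 'I_n}) (c : config n) : dist (config n) :=
  dbind (dseq [seq @node_step n k l (u \in B) (c.2 u) | u <- enum 'I_n])
        (fun r => dret (assemble r)).

(** Initial configuration: every node holds its initial value x0 u and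
    (as if it had just updated) sends it to k uniformly random nodes. *)
Definition init_config (n k : nat) (x0 : 'I_n -> bool) : dist (config n) :=
  dbind (dseq [seq dbind (duniform (enum {: k.-tuple 'I_n}))
                      (fun ts => dret (Some (x0 u), val ts)) | u <- enum 'I_n])
        (fun r => dret (assemble r)).

(** A late adaptive adversary: the blocked set of round t is a function of
    the configurations at the beginning of rounds 1, ..., t-1. *)
Definition adversary (n : nat) := seq (config n) -> {set 'I_n}.

Definition eps_bounded (n : nat) (eps : R) (adv : adversary n) : Prop :=
  forall h, (#|adv h|%:R : R) <= eps * n%:R.

Fixpoint run (n k l : nat) (adv : adversary n) (T : nat) (hist : seq (config n))
  (c : config n) : dist (config n) :=
  match T with
  | 0%N => dret c
  | T'.+1 => dbind (round k l (adv hist) c) (fun c' => run k l adv T' (rcons hist c) c')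
  end.

Definition process (n k l : nat) (adv : adversary n) (x0 : 'I_n -> bool) (T : nat)
  : dist (config n) :=
  dbind (init_config k x0) (fun c1 => run k l adv T [::] c1).

Definition almost_agree (n : nat) (gamma : R) (c : config n) : bool :=
  [exists b : bool, (1 - gamma) * n%:R <= (#|[set u | c.1 u == Some b]|%:R : R)].

End Model.

(* Main.v *)
Require Import Defs.
From HB Require Import structures.
From mathcomp Require Import all_boot all_order all_algebra.
From mathcomp Require Import reals exp sequences.
From mathcomp Require Import ring lra.
Set Implicit Arguments. Unset Strict Implicit. Unset Printing Implicit Defensive.
Import Order.TTheory GRing.Theory Num.Theory.
Local Open Scope ring_scope.

(** The state is cut between updating and sending, when only the values are known: the blocked set
    depends on earlier configurations alone, so it is a constant while the next targets are drawn.
    With 2n/3 defined nodes there are at least 4n messages, an inbox gets three values with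
    probability at least 3/4, and (15/16)(3/4) = 45/64 exceeds 2/3; eps <= 1/16 leaves this margin.
    If ndef >= 2n/3 and |delta| >= 2n/5, the leading value has at least 8n/15 nodes, hence gamma =
    7/15. One potential replaces separate phases for breaking a tie and for amplifying a bias: as
    long as |delta| < 2n/5 it lies between order 1/n and 1, so O(log n) contractions and Markov's
    inequality suffice. Markov costs a factor of order n, so the chance of falling back from |delta|
    >= 2n/5 must be well below 1/n per round; Chebyshev gives only O(1/n), which is why fourth
    moments are tracked. The loss of defined nodes is counted outside the potential, where O(1/n)
    per round is enough. *)

(** After a round let delta be the number of ones minus the number of zeros and
    ndef the number of defined nodes. The six messages of every defined node land
    in independent uniform inboxes, and the adversary has fixed the blocked set
    before they are drawn. By exchangeability of the messages the mean of the next
    delta is that of a majority of three messages drawn from all of them, whence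
    |mean| >= 1.1 * min(|delta|, 2n/5) as long as ndef >= 2n/3; bounded
    differences give a variance O(n) and a fourth central moment O(n^2), and the
    inboxes with two ones and two zeros give a variance of order at least n. Hence
    the potential 1 / (1 + slope * delta^2 / n) contracts in expectation by a
    constant factor per round: near delta = 0 because of the noise, elsewhere
    because of the drift. Once |delta| >= 2n/5 it stays so by the fourth moment
    bound, and ndef >= 2n/3 persists by Chebyshev's inequality. *)

(** * Expectations over finite weighted lists *)

Section Expectation.
Variable R : realType.
Implicit Types A B : Type.

Definition Ex A (d : dist R A) (f : A -> R) : R := \sum_(pw <- d) pw.1 * f pw.2.

(** A [dist] is a bare weighted list, so nonnegative weights and total mass one have to be carried
    separately. *)
Definition isprob A (d : dist R A) : Prop :=
  all (fun pw => 0 <= pw.1) d /\ \sum_(pw <- d) pw.1 = 1.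

Lemma eq_Ex A (d : dist R A) f g : f =1 g -> Ex d f = Ex d g.
Proof. by move=> fg; apply: eq_bigr => pw _; rewrite fg. Qed.

Lemma Ex_ret A (a : A) f : Ex (dret R a) f = f a.
Proof. by rewrite /Ex /dret big_seq1 mul1r. Qed.

Lemma Ex_bind A B (d : dist R A) (k : A -> dist R B) f :
  Ex (dbind d k) f = Ex d (fun a => Ex (k a) f).
Proof.
rewrite /Ex /dbind big_flatten big_map; apply: eq_bigr => pw _.
by rewrite big_map mulr_sumr; apply: eq_bigr => qy _ /=; rewrite mulrA.
Qed.

Lemma ExD A (d : dist R A) f g : Ex d (fun a => f a + g a) = Ex d f + Ex d g.
Proof. by rewrite /Ex -big_split; apply: eq_bigr => pw _; rewrite mulrDr. Qed.

Lemma ExZ A (d : dist R A) c f : Ex d (fun a => c * f a) = c * Ex d f.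
Proof. by rewrite /Ex mulr_sumr; apply: eq_bigr => pw _; rewrite mulrCA. Qed.

Lemma ExN A (d : dist R A) f : Ex d (fun a => - f a) = - Ex d f.
Proof. by rewrite /Ex -sumrN; apply: eq_bigr => pw _; rewrite mulrN. Qed.

Lemma Ex_cst A (d : dist R A) c : isprob d -> Ex d (fun=> c) = c.
Proof. by case=> _ s1; rewrite /Ex -mulr_suml s1 mul1r. Qed.

Lemma Ex_sum A (I : Type) (s : seq I) (d : dist R A) (F : I -> A -> R) :
  Ex d (fun a => \sum_(i <- s) F i a) = \sum_(i <- s) Ex d (F i).
Proof. by rewrite /Ex exchange_big; apply: eq_bigr => pw _; rewrite mulr_sumr. Qed.

Lemma Ex_exchange A B (d : dist R A) (e : dist R B) (f : A -> B -> R) :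
  Ex d (fun a => Ex e (f a)) = Ex e (fun b => Ex d (f^~ b)).
Proof.
transitivity (Ex d (fun a => \sum_(pw <- e) pw.1 * f a pw.2)) => //.
by rewrite Ex_sum; apply: eq_bigr => pw _; rewrite ExZ.
Qed.

Lemma ler_Ex A (d : dist R A) f g :
  isprob d -> (forall a, f a <= g a) -> Ex d f <= Ex d g.
Proof.
case=> d0 _ fg; rewrite /Ex; elim: d d0 => [|pw d IH] /=; first by rewrite !big_nil.
by case/andP=> p0 d0; rewrite !big_cons lerD ?IH ?ler_wpM2l.
Qed.

Lemma Ex_ge0 A (d : dist R A) f : isprob d -> (forall a, 0 <= f a) -> 0 <= Ex d f.
Proof. by move=> dp f0; rewrite -(Ex_cst 0 dp); apply: ler_Ex. Qed.

Lemma Ex_le A (d : dist R A) f c : isprob d -> (forall a, f a <= c) -> Ex d f <= c.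
Proof. by move=> dp fc; rewrite -[leRHS](Ex_cst c dp); apply: ler_Ex. Qed.

Lemma Ex_ge A (d : dist R A) f c : isprob d -> (forall a, c <= f a) -> c <= Ex d f.
Proof. by move=> dp fc; rewrite -[leLHS](Ex_cst c dp); apply: ler_Ex. Qed.

Lemma norm_Ex_le A (d : dist R A) f c :
  isprob d -> (forall a, `|f a| <= c) -> `|Ex d f| <= c.
Proof.
move=> dp fc; rewrite ler_norml Ex_ge ?Ex_le// => a; have := fc a;
  by rewrite ler_norml => /andP[].
Qed.

Lemma prob_Ex A (d : dist R A) P : prob d P = Ex d (fun a => (P a)%:R).
Proof.
by apply: eq_bigr => pw _; case: (P pw.2); rewrite ?mulr1 ?mulr0.
Qed.

Lemma isprob_ret A (a : A) : isprob (dret R a).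
Proof. by split; rewrite /dret /= ?ler01 ?big_seq1. Qed.

Lemma isprob_bind A B (d : dist R A) (k : A -> dist R B) :
  isprob d -> (forall a, isprob (k a)) -> isprob (dbind d k).
Proof.
move=> dp kp; split.
  rewrite /dbind; have [d0 _] := dp.
  elim: d d0 {dp} => //= pw d IH /andP[p0 d0]; rewrite all_cat IH// andbT all_map.
  by apply: sub_all (kp pw.2).1 => qy q0 /=; rewrite mulr_ge0.
have : Ex (dbind d k) (fun=> 1) = 1.
  by rewrite Ex_bind (@eq_Ex _ d _ (fun=> 1)) ?Ex_cst// => a; rewrite Ex_cst.
by rewrite /Ex; under eq_bigr do rewrite mulr1.
Qed.

Lemma Ex_uniform A (s : seq A) f :
  Ex (duniform R s) f = (size s)%:R^-1 * \sum_(a <- s) f a.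
Proof. by rewrite /Ex /duniform big_map mulr_sumr; apply: eq_bigr => a _; rewrite div1r. Qed.

Lemma isprob_uniform A (s : seq A) : (0 < size s)%N -> isprob (duniform R s).
Proof.
move=> s0; split.
  rewrite /duniform all_map; apply: sub_all (all_predT s) => a _ /=.
  by rewrite divr_ge0.
rewrite /duniform big_map big_const_seq count_predT iter_addr addr0 /= div1r.
by rewrite -[LHS]mulr_natr mulVf// pnatr_eq0 -lt0n.
Qed.

Lemma Ex_dseq0 A f : Ex (dseq [::] : dist R (seq A)) f = f [::].
Proof. exact: Ex_ret. Qed.

Lemma Ex_dseq_cons A (d : dist R A) l f :
  Ex (dseq (d :: l)) f = Ex d (fun a => Ex (dseq l) (fun r => f (a :: r))).
Proof.
rewrite /= Ex_bind; apply: eq_Ex => a; rewrite Ex_bind; apply: eq_Ex => r.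
exact: Ex_ret.
Qed.

Lemma isprob_dseq A I (s : seq I) (k : I -> dist R A) :
  (forall i, isprob (k i)) -> isprob (dseq (map k s)).
Proof.
move=> kp; elim: s => [|i s IH] /=; first exact: isprob_ret.
by apply: isprob_bind => // a; apply: isprob_bind => // r; apply: isprob_ret.
Qed.

(** [dseq l] charges only lists as long as [l], and [zip], [nth] and [assemble] behave well only at
    that length. *)
Lemma eq_Ex_dseq A (l : seq (dist R A)) f g :
  (forall r, size r = size l -> f r = g r) -> Ex (dseq l) f = Ex (dseq l) g.
Proof.
elim: l f g => [|d l IH] f g fg; first by rewrite !Ex_dseq0 fg.
rewrite !Ex_dseq_cons; apply: eq_Ex => a; apply: IH => r sr.
by apply: fg; rewrite /= sr.
Qed.

Lemma ler_Ex_dseq A I (s : seq I) (k : I -> dist R A) f g :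
  (forall i, isprob (k i)) ->
  (forall r, size r = size s -> f r <= g r) ->
  Ex (dseq (map k s)) f <= Ex (dseq (map k s)) g.
Proof.
move=> kp; elim: s f g => [|i s IH] f g fg; first by rewrite !Ex_dseq0 fg.
rewrite !Ex_dseq_cons; apply: ler_Ex => // a; apply: IH => r sr.
by apply: fg; rewrite /= sr.
Qed.

Lemma Ex_dseq_cat A (l1 l2 : seq (dist R A)) f :
  Ex (dseq (l1 ++ l2)) f =
  Ex (dseq l1) (fun r1 => Ex (dseq l2) (fun r2 => f (r1 ++ r2))).
Proof.
elim: l1 f => [|d l1 IH] f; first by rewrite Ex_dseq0.
by rewrite cat_cons !Ex_dseq_cons; apply: eq_Ex => a; rewrite IH.
Qed.

Lemma eq_dseq_Ex A I (s : seq I) (k k' : I -> dist R A) f :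
  (forall i h, Ex (k i) h = Ex (k' i) h) ->
  Ex (dseq (map k s)) f = Ex (dseq (map k' s)) f.
Proof.
move=> kk; elim: s f => [|i s IH] f; first by rewrite !Ex_dseq0.
by rewrite !Ex_dseq_cons kk; apply: eq_Ex => a; rewrite IH.
Qed.

(** Independent pairs may be drawn with all first components first. This splits a round into all
    updates followed by all sends, although [node_step] does both node by node. *)
Lemma Ex_dseq_pair A B I (s : seq I) (vd : I -> dist R A) (td : A -> dist R B) H :
  Ex (dseq [seq dbind (vd i) (fun v => dbind (td v) (fun t => dret R (v, t))) | i <- s]) H =
  Ex (dseq (map vd s)) (fun x => Ex (dseq (map td x)) (fun t => H (zip x t))).
Proof.
elim: s H => [|i s IH] H; first by rewrite !Ex_dseq0.
rewrite !Ex_dseq_cons Ex_bind; apply: eq_Ex => v.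
rewrite Ex_bind.
under eq_Ex do rewrite Ex_ret IH.
rewrite Ex_exchange; apply: eq_Ex => x.
by rewrite Ex_dseq_cons.
Qed.

Lemma Ex_dseq_sum A I (r : seq I) (k : I -> dist R A) (s : A -> R) :
  (forall i, isprob (k i)) ->
  Ex (dseq (map k r)) (fun x => \sum_(o <- x) s o) = \sum_(i <- r) Ex (k i) s.
Proof.
move=> kp; elim: r => [|i r IH]; first by rewrite Ex_dseq0 !big_nil.
rewrite Ex_dseq_cons big_cons -IH.
under eq_Ex => a.
  under eq_Ex do rewrite big_cons.
  rewrite ExD Ex_cst; last exact: isprob_dseq.
  over.
by rewrite ExD Ex_cst.
Qed.

Lemma Ex_centered A (d : dist R A) f : isprob d -> Ex d (fun a => f a - Ex d f) = 0.
Proof. by move=> dp; rewrite ExD Ex_cst// subrr. Qed.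

(** The cross term vanishes because [f] is centered. Splitting a squared deviation into a
    conditional part and a centered rest goes through this identity. *)
Lemma Ex_sqr_shift A (d : dist R A) f G :
  isprob d -> Ex d f = 0 -> Ex d (fun a => (G + f a) ^+ 2) = G ^+ 2 + Ex d (fun a => f a ^+ 2).
Proof.
move=> dp f0; under eq_Ex => a do rewrite sqrrD -mulrnAl.
by rewrite !ExD (ExZ d (G *+ 2) f) f0 mulr0 addr0 Ex_cst//.
Qed.

Lemma Ex_sqr_ge A (d : dist R A) f :
  isprob d -> Ex d f ^+ 2 <= Ex d (fun a => f a ^+ 2).
Proof.
move=> dp.
have -> : Ex d (fun a => f a ^+ 2) = Ex d (fun a => (Ex d f + (f a - Ex d f)) ^+ 2).
  by apply: eq_Ex => a; rewrite addrC subrK.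
by rewrite Ex_sqr_shift ?Ex_centered// lerDl Ex_ge0// => a; apply: sqr_ge0.
Qed.

Lemma variance_dseq_sum A I (r : seq I) (k : I -> dist R A) (s : A -> R) :
  (forall i, isprob (k i)) ->
  Ex (dseq (map k r)) (fun x => (\sum_(o <- x) s o - \sum_(i <- r) Ex (k i) s) ^+ 2) =
  \sum_(i <- r) (Ex (k i) (fun o => s o ^+ 2) - Ex (k i) s ^+ 2).
Proof.
move=> kp; elim: r => [|i r IH]; first by rewrite Ex_dseq0 !big_nil subr0 expr0n.
rewrite Ex_dseq_cons !big_cons -IH.
set T := \sum_(j <- r) _; set m := Ex (k i) s.
have pr : isprob (dseq (map k r)) by apply: isprob_dseq.
under eq_Ex => a.
  under eq_Ex => x do rewrite big_cons opprD addrACA.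
  rewrite Ex_sqr_shift//; last by rewrite ExD Ex_dseq_sum// Ex_cst// subrr.
  over.
rewrite ExD Ex_cst//; congr (_ + _).
transitivity (Ex (k i) (fun a => s a ^+ 2 + ((- 2 * m) * s a + m ^+ 2))).
  by apply: eq_Ex => a; ring.
by rewrite !ExD (ExZ (k i) (- 2 * m) s) Ex_cst// -/m; ring.
Qed.

End Expectation.

(** * Second and fourth moments under bounded differences *)

Section BoundedDifferences.
Variables (R : realType) (A : Type).

Definition bdiff (c : R) (f : seq A -> R) : Prop :=
  forall r1 a a' r2, `|f (r1 ++ a :: r2) - f (r1 ++ a' :: r2)| <= c.

Lemma bdiff_avg c (d : dist R A) f :
  isprob d -> bdiff c f -> bdiff c (fun r => Ex d (fun a => f (a :: r))).
Proof.
move=> dp fc r1 a a' r2; rewrite -ExN -ExD; apply: norm_Ex_le => // b.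
exact: (fc (b :: r1)).
Qed.

Lemma bdiff_head c (d : dist R A) f r a :
  isprob d -> bdiff c f -> `|f (a :: r) - Ex d (fun b => f (b :: r))| <= c.
Proof.
move=> dp fc; rewrite -[f (a :: r)](Ex_cst _ dp) -ExN -ExD.
by apply: norm_Ex_le => // b; apply: (fc [::]).
Qed.

(* The Doob increments for averaging out the first coordinate are centered and
   bounded by c; the fourth moment uses 4 G D^3 <= 2 G^2 D^2 + 2 D^4. *)
Lemma bdiff_moments c I (s : seq I) (k : I -> dist R A) f :
  (forall i, isprob (k i)) -> bdiff c f -> let m := Ex (dseq (map k s)) f in
  Ex (dseq (map k s)) (fun r => (f r - m) ^+ 2) <= (size s)%:R * c ^+ 2 /\
  Ex (dseq (map k s)) (fun r => (f r - m) ^+ 4) <= 4 * (size s)%:R ^+ 2 * c ^+ 4.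
Proof.
move=> kp; elim: s f => [|i s IH] f fc /=.
  by rewrite !Ex_dseq0 subrr !expr0n /= !mul0r mulr0 mul0r.
set g := fun r => Ex (k i) (fun a => f (a :: r)).
have -> : Ex (dseq (k i :: map k s)) f = Ex (dseq (map k s)) g.
  by rewrite Ex_dseq_cons Ex_exchange.
set m := Ex _ g; have [IH2 IH4] := IH _ (bdiff_avg (kp i) fc).
rewrite -/g -/m in IH2 IH4.
have ps : isprob (dseq (map k s)) by apply: isprob_dseq.
have D0 r : Ex (k i) (fun a => f (a :: r) - g r) = 0.
  by rewrite ExD Ex_cst// subrr.
have Dc r a : `|f (a :: r) - g r| <= c by apply: bdiff_head.
have D2 r a : (f (a :: r) - g r) ^+ 2 <= c ^+ 2.
  by rewrite -[leLHS]real_normK ?num_real// lerXn2r ?nnegrE ?(le_trans _ (Dc r a)).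
rewrite !Ex_dseq_cons !(Ex_exchange (k i)) -natr1; split.
  rewrite mulrDl mul1r.
  apply: (le_trans (y := Ex (dseq (map k s)) (fun r => (g r - m) ^+ 2 + c ^+ 2))).
    apply: ler_Ex => // r.
    under eq_Ex => a do rewrite -(subrK (g r) (f _)) -addrA addrC.
    by rewrite Ex_sqr_shift// lerD2l Ex_le.
  by rewrite ExD Ex_cst// lerD2r.
apply: (le_trans (y := Ex (dseq (map k s)) (fun r => (g r - m) ^+ 4
    + (8 * c ^+ 2) * (g r - m) ^+ 2 + 3 * c ^+ 4))).
  apply: ler_Ex => // r; set G := g r - m.
  apply: (le_trans (y := Ex (k i) (fun a => G ^+ 4 + 8 * c ^+ 2 * G ^+ 2 + 3 * c ^+ 4
     + (4 * G ^+ 3) * (f (a :: r) - g r)))).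
    apply: ler_Ex => // a; set D := f (a :: r) - g r.
    have -> : f (a :: r) - m = G + D by rewrite /G /D; ring.
    have d2 : D ^+ 2 <= c ^+ 2 by apply: D2.
    have d4 : D ^+ 4 <= c ^+ 4.
      by rewrite (exprM D 2 2) (exprM c 2 2) lerXn2r ?nnegrE ?sqr_ge0.
    have gd : G ^+ 2 * D ^+ 2 <= G ^+ 2 * c ^+ 2 by rewrite ler_wpM2l ?sqr_ge0.
    have sq : 0 <= (G * D - D ^+ 2) ^+ 2 by apply: sqr_ge0.
    have -> : (G + D) ^+ 4 = G ^+ 4 + 4 * G ^+ 3 * D + 8 * (G ^+ 2 * D ^+ 2) + 3 * D ^+ 4
        - 2 * (G * D - D ^+ 2) ^+ 2 by ring.
    lra.
  by rewrite ExD ExZ D0 mulr0 addr0 Ex_cst.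
rewrite !ExD Ex_cst// (ExZ _ (8 * c ^+ 2) (fun r => (g r - m) ^+ 2)).
have c4 : 0 <= c ^+ 4 by rewrite (exprM c 2 2) sqr_ge0.
have c2 : 8 * c ^+ 2 * Ex (dseq (map k s)) (fun r => (g r - m) ^+ 2) <=
   8 * c ^+ 2 * ((size s)%:R * c ^+ 2) by apply: ler_wpM2l => //; rewrite mulr_ge0 ?sqr_ge0.
(* In units of c^4 and with s the size, one coordinate adds 8 s + 3, while 4 (s + 1)^2 - 4 s^2 = 8 s
   + 4; hence the factor 4 in the bound. *)
have -> : 4 * ((size s)%:R + 1) ^+ 2 * c ^+ 4 = 4 * (size s)%:R ^+ 2 * c ^+ 4 +
   8 * c ^+ 2 * ((size s)%:R * c ^+ 2) + 4 * c ^+ 4 by ring.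
lra.
Qed.

End BoundedDifferences.

(** * Binomial expectations by recursion on the number of trials *)

Section Binomial.
Variables (R : realType) (p : R).

(* Expectation of F at a binomial (A, p) variable. *)
Fixpoint bn (A : nat) (F : nat -> R) : R :=
  if A is A'.+1 then p * bn A' (fun i => F i.+1) + (1 - p) * bn A' F else F 0%N.

Lemma eq_bn A F G : F =1 G -> bn A F = bn A G.
Proof.
by elim: A F G => [|A IH] F G FG //=; rewrite (IH F G)// (IH _ (fun i => G i.+1)).
Qed.

Lemma bnD A F G : bn A (fun i => F i + G i) = bn A F + bn A G.
Proof.
elim: A F G => [|A IH] F G //=.
by rewrite (IH (fun i => F i.+1) (fun i => G i.+1)) IH; ring.
Qed.

Lemma bnZ A c F : bn A (fun i => c * F i) = c * bn A F.
Proof.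
elim: A F => [|A IH] F //=.
by rewrite (IH (fun i => F i.+1)) IH; ring.
Qed.

Lemma bnN A F : bn A (fun i => - F i) = - bn A F.
Proof. by rewrite -mulN1r -bnZ; apply: eq_bn => i; rewrite mulN1r. Qed.

Lemma bn_cst A c : bn A (fun=> c) = c.
Proof. by elim: A => [|A IH] //=; rewrite IH; ring. Qed.

Lemma bnS A F : bn A.+1 F = p * bn A (fun i => F i.+1) + (1 - p) * bn A F.
Proof. by []. Qed.

Lemma ler_bn A F G : 0 <= p <= 1 -> (forall i, F i <= G i) -> bn A F <= bn A G.
Proof.
move=> /andP[p0 p1]; elim: A F G => [|A IH] F G FG //=.
by rewrite lerD// ler_wpM2l ?subr_ge0// IH.
Qed.

Lemma bn_add A B F : bn A (fun i => bn B (fun j => F (i + j)%N)) = bn (A + B) F.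
Proof.
elim: A F => [|A IH] F //=.
by rewrite -(IH (fun i => F i.+1)) -IH.
Qed.

(** Size biasing: marking one success leaves a binomial on the other [A.-1] trials. *)
Lemma bn_size_bias A F :
  bn A (fun i => i%:R * F i) = A%:R * p * bn A.-1 (fun i => F i.+1).
Proof.
elim: A F => [|A IH] F; first by rewrite /= !mul0r.
have E : bn A (fun i => i.+1%:R * F i.+1) =
    A%:R * p * bn A.-1 (fun i => F i.+2) + bn A (fun i => F i.+1).
  rewrite -(IH (fun i => F i.+1)) -bnD; apply: eq_bn => i.
  by rewrite -natr1; ring.
rewrite bnS E IH [A.+1.-1]/= -[A.+1%:R]natr1.
case: A {IH E} => [|A]; first by rewrite /= ; ring.
by rewrite [A.+1.-1]/= (bnS A (fun i => F i.+1)); ring.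
Qed.

Lemma bn_ffact r A F :
  bn A (fun i => (i ^_ r)%:R * F i) = (A ^_ r)%:R * p ^+ r * bn (A - r) (fun i => F (i + r)%N).
Proof.
elim: r A F => [|r IH] A F.
  rewrite ffactn0 expr0 !mul1r subn0; apply: eq_bn => i.
  by rewrite ffactn0 mul1r addn0.
transitivity (bn A (fun i => i%:R * ((i.-1 ^_ r)%:R * F i))).
  by apply: eq_bn => i; rewrite ffactnS natrM mulrA.
rewrite bn_size_bias (IH _ (fun i => F i.+1)) ffactnS natrM exprS.
rewrite -subn1 -subnDA add1n !mulrA; congr (_ * _); first by ring.
by apply: eq_bn => i; rewrite addnS.
Qed.

Lemma bn_point A r : bn A (fun i => (i == r)%:R) = 'C(A, r)%:R * p ^+ r * (1 - p) ^+ (A - r).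
Proof.
elim: A r => [|A IH] r.
  by rewrite /= bin0n; case: r => [|r] /=; rewrite ?mul1r ?expr0 ?mulr1 // !mul0r.
rewrite bnS IH; case: r => [|r].
  rewrite (@eq_bn A _ (fun=> 0)) // bn_cst !bin0 subn0 subSn// subn0 exprS; ring.
rewrite (@eq_bn A _ (fun i => (i == r)%:R)) // IH subSS binS natrD.
have [rA|Ar] := leqP r.+1 A; last by rewrite (bin_small Ar) exprS; ring.
by rewrite -(subnSK rA) !exprS; ring.
Qed.

Lemma bn_lt3 A : bn A (fun i => (i < 3)%N%:R) =
  (1 - p) ^+ A + A%:R * p * (1 - p) ^+ (A - 1) + 'C(A, 2)%:R * p ^+ 2 * (1 - p) ^+ (A - 2).
Proof.
have -> : bn A (fun i => (i < 3)%N%:R) =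
    bn A (fun i => (i == 0)%N%:R + (i == 1)%N%:R + (i == 2)%N%:R).
  by apply: eq_bn => -[|[|[|i]]] /=; rewrite ?addr0 ?add0r.
by rewrite !bnD !bn_point bin0 bin1 subn0 expr0 expr1; ring.
Qed.

(** Coupling: the load from [A] balls is part of the load from [B] balls. *)
Lemma bn_lt3_anti A B : 0 <= p <= 1 -> (A <= B)%N ->
  bn B (fun i => (i < 3)%N%:R) <= bn A (fun i => (i < 3)%N%:R).
Proof.
move=> p01 /subnK <-; rewrite addnC -bn_add; apply: ler_bn => // i.
rewrite -[leRHS](bn_cst (B - A)); apply: ler_bn => // j.
rewrite ler_nat; case: (ltnP (i + j) 3) => // ij.
by rewrite (leq_ltn_trans (leq_addr _ _) ij).
Qed.

(** Once [a] balls of one colour and [b] of the other are marked, the rest enters through its total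
    only, so two colours reduce to a single binomial depending on [a + b]. This is the source of
    exchangeability. *)
Lemma bn_ffact2 A B a b F : bn A (fun i => bn B (fun j => (i ^_ a * j ^_ b)%:R * F (i + j)%N)) =
  (A ^_ a * B ^_ b)%:R * p ^+ (a + b) * bn (A + B - (a + b)) (fun m => F (m + (a + b))%N).
Proof.
transitivity (bn A (fun i => (i ^_ a)%:R * ((B ^_ b)%:R * p ^+ b *
    bn (B - b) (fun j => F (i + (j + b))%N)))).
  apply: eq_bn => i; rewrite -(bn_ffact b B (fun j => F (i + j)%N)) -bnZ.
  by apply: eq_bn => j; rewrite natrM mulrA.
rewrite bn_ffact bnZ natrM exprD.
(* Truncated subtraction does no harm: if a > A or b > B, a falling factorial kills both sides. *)
have [aA|Aa] := leqP a A; last by rewrite (ffact_small Aa) !mul0r.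
have [bB|Bb] := leqP b B; last by rewrite (ffact_small Bb) !(mul0r, mulr0).
have -> : (A + B - (a + b) = (A - a) + (B - b))%N.
  by rewrite -{1}(subnK aA) -{1}(subnK bB) addnACA addnK.
rewrite -bn_add -!mulrA; congr (_ * _).
rewrite [RHS]mulrCA; congr (_ * _); congr (_ * _); congr (_ * _).
by apply: eq_bn => i; apply: eq_bn => j; rewrite addnACA.
Qed.

End Binomial.

(** * Mean majority of three balls from a two-coloured urn *)

Section MajorityOfThree.
Variable R : realType.

(** Signed count of the ordered triples of distinct balls among [i] ones and [j] zeros, +1 for a
    majority of ones and -1 for a majority of zeros. Divided by the number of triples it is the mean
    sign. *)
Definition maj_num (i j : nat) : R :=
  (i ^_ 3)%:R + 3 * (i ^_ 2 * j)%:R - 3 * (i * j ^_ 2)%:R - (j ^_ 3)%:R.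

Lemma ffact2R (i : nat) : (i ^_ 2)%:R = i%:R * (i%:R - 1) :> R.
Proof.
case: i => [|i]; first by rewrite mul0r.
by rewrite ffactnS ffactn1 natrM /= -[i.+1%:R]natr1; ring.
Qed.

Lemma ffact3R (i : nat) : (i ^_ 3)%:R = i%:R * (i%:R - 1) * (i%:R - 2) :> R.
Proof.
case: i => [|i]; first by rewrite !mul0r.
by rewrite ffactnS natrM ffact2R /= -[i.+1%:R]natr1; ring.
Qed.

(** Factoring out the difference shows the next mean [delta] as a multiple of the present one. *)
Lemma maj_numE (i j : nat) : maj_num i j =
  (i%:R - j%:R) * ((i%:R + j%:R - 1) * (i%:R + j%:R - 2) + 2 * i%:R * j%:R).
Proof. by rewrite /maj_num (natrM _ (i ^_ 2) j) (natrM _ i (j ^_ 2)) !ffact2R !ffact3R; ring. Qed.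

(* Exchangeability of the balls: the mean majority of three balls of a bin is
   that of three balls drawn from all of them. *)
Lemma bn_majority (p : R) (A B : nat) :
  bn p A (fun i => bn p B (fun j => maj_num i j / ((i + j) ^_ 3)%:R)) * ((A + B) ^_ 3)%:R =
  maj_num A B * bn p (A + B) (fun m => (2 < m)%N%:R).
Proof.
(* For m < 3 both the falling factorial and its inverse are 0, so an inbox with fewer than three
   values contributes 0, like an undefined node. *)
pose F m : R := (m ^_ 3)%:R^-1.
have E a b : (a + b = 3)%N ->
    bn p A (fun i => bn p B (fun j => (i ^_ a * j ^_ b)%:R * F (i + j)%N)) =
    (A ^_ a * B ^_ b)%:R * (p ^+ 3 * bn p (A + B - 3) (fun m => F (m + 3)%N)).
  by move=> ab; rewrite bn_ffact2 ab mulrA.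
have -> : bn p A (fun i => bn p B (fun j => maj_num i j / ((i + j) ^_ 3)%:R)) =
    maj_num A B * (p ^+ 3 * bn p (A + B - 3) (fun m => F (m + 3)%N)).
  transitivity (bn p A (fun i => bn p B (fun j => (i ^_ 3 * j ^_ 0)%:R * F (i + j)%N))
    + 3 * bn p A (fun i => bn p B (fun j => (i ^_ 2 * j ^_ 1)%:R * F (i + j)%N))
    - 3 * bn p A (fun i => bn p B (fun j => (i ^_ 1 * j ^_ 2)%:R * F (i + j)%N))
    - bn p A (fun i => bn p B (fun j => (i ^_ 0 * j ^_ 3)%:R * F (i + j)%N))).
    rewrite -!(bnZ, bnN) -!bnD; apply: eq_bn => i.
    rewrite -!(bnZ, bnN) -!bnD; apply: eq_bn => j.
    by rewrite /maj_num /F !ffactn0 !ffactn1 muln1 mul1n; ring.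
  by rewrite !E// /maj_num !ffactn0 !ffactn1 muln1 mul1n; ring.
have -> : bn p (A + B) (fun m => (2 < m)%N%:R) =
    ((A + B) ^_ 3)%:R * (p ^+ 3 * bn p (A + B - 3) (fun m => F (m + 3)%N)).
  rewrite mulrA -bn_ffact; apply: eq_bn => m; rewrite /F.
  have [m3|m3] := ltnP 2 m; last by rewrite ffact_small// mul0r.
  by rewrite divff// pnatr_eq0 -lt0n ffact_gt0.
by ring.
Qed.

End MajorityOfThree.

(** A set is determined by its parts inside and outside [U]. With [U] the positions of the ones,
    this is the hypergeometric law of the sampled ones. *)
Lemma card_draws_meet (T : finType) (U : {set T}) (k r : nat) : (r <= k)%N ->
  #|[set S : {set T} | (#|S| == k) && (#|S :&: U| == r)]| =
  ('C(#|U|, r) * 'C(#|~: U|, k - r))%N.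
Proof.
move=> rk.
pose X := [set S : {set T} | S \subset U & #|S| == r].
pose Y := [set S : {set T} | S \subset ~: U & #|S| == (k - r)%N].
rewrite -(cards_draws U r) -(cards_draws (~: U) (k - r)%N) -/X -/Y -cardsX.
have mU (S1 S2 : {set T}) : S1 \subset U -> S2 \subset ~: U -> (S1 :|: S2) :&: U = S1.
  move=> s1 s2; rewrite setIUl (setIidPl s1); apply/setUidPl.
  by have := s2; rewrite subsets_disjoint setCK -setI_eq0 => /eqP ->; rewrite sub0set.
have mC (S1 S2 : {set T}) : S1 \subset U -> S2 \subset ~: U -> (S1 :|: S2) :\: U = S2.
  move=> s1 s2; rewrite setDUl; have /eqP -> : S1 :\: U == set0 by rewrite setD_eq0.
  by rewrite set0U setDE; apply/setIidPl.
rewrite -(card_in_imset (f := fun q : {set T} * {set T} => q.1 :|: q.2)); last first.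
  move=> [S1 S2] [S1' S2']; rewrite !inE /= => /andP[/andP[a _] /andP[b _]].
  move=> /andP[/andP[a' _] /andP[b' _]] e.
  have -> : S1 = S1' by rewrite -(mU _ _ a b) e mU.
  by have -> : S2 = S2' by rewrite -(mC _ _ a b) e mC.
apply: eq_card => S; apply/idP/imsetP.
  rewrite inE => /andP[/eqP Sk /eqP Sr]; exists (S :&: U, S :\: U); last by rewrite /= setID.
  rewrite !inE /= subsetIr Sr eqxx setDE subsetIr /= -setDE cardsD Sk Sr//.
move=> [[S1 S2]]; rewrite !inE /= => /andP[/andP[a /eqP c1] /andP[b /eqP c2]] ->.
rewrite mU// c1 eqxx andbT cardsU.
have -> : S1 :&: S2 = set0.
  apply/eqP; rewrite setI_eq0 disjoint_sym.
  by apply: disjointWr a _; rewrite disjoints_subset.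
by rewrite cards0 subn0 c1 c2 subnKC.
Qed.

(** * The update of a single node *)

Section Node.
Variable R : realType.

(** The value half of [node_step] at l = 3; the choice of targets is split off into [tdist]. *)
Definition vdist (blk : bool) (s : seq bool) : dist R (option bool) :=
  if blk || (size s < 3)%N then dret R None
  else dbind (duniform R (enum [set S : {set 'I_(size s)} | #|S| == 3%N]))
         (fun S => dret R (Some (majority [seq nth false s (nat_of_ord i) | i in S]))).

Definition sg (o : option bool) : R :=
  match o with Some true => 1 | Some false => -1 | None => 0 end.

Definition defd (o : option bool) : R := (isSome o)%:R.

Lemma sg_sqr o : sg o ^+ 2 = defd o.
Proof. by case: o => [[]|]; rewrite /sg /defd /= ?sqrrN ?expr1n ?expr0n. Qed.

Lemma sg_norm o : `|sg o| <= 1.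
Proof. by case: o => [[]|]; rewrite /sg ?normrN ?normr1 ?normr0 ?ler01. Qed.

Lemma size_draws (m k : nat) : size (enum [set S : {set 'I_m} | #|S| == k]) = 'C(m, k).
Proof. by rewrite -cardE card_draws card_ord. Qed.

Lemma isprob_vdist blk s : isprob (vdist blk s).
Proof.
rewrite /vdist; case: ifP => [_|/norP[_]]; first exact: isprob_ret.
rewrite -leqNgt => s3.
apply: isprob_bind => [|S]; last exact: isprob_ret.
by apply: isprob_uniform; rewrite size_draws bin_gt0.
Qed.

Lemma Ex_vdist_defd blk s : Ex (vdist blk s) defd = (~~ blk && (2 < size s)%N)%:R.
Proof.
rewrite ltnNge -ltnS -negb_or /vdist; case: ifP => [_|/norP[_]]; first by rewrite Ex_ret.
rewrite -leqNgt => s3.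
rewrite Ex_bind (@eq_Ex _ _ _ _ (fun=> 1)) => [|S]; last by rewrite Ex_ret.
by rewrite Ex_cst//; apply: isprob_uniform; rewrite size_draws bin_gt0.
Qed.

Lemma count_ord (s : seq bool) :
  #|[set i : 'I_(size s) | nth false s i]| = count id s.
Proof.
rewrite -sum1dep_card -sum1_count (big_nth false) big_mkord.
by apply: eq_bigl => i.
Qed.

Lemma count_image (m : nat) (s : seq bool) (S : {set 'I_m}) :
  count id [seq nth false s (nat_of_ord i) | i in S] =
  #|S :&: [set i : 'I_m | nth false s i]|.
Proof.
rewrite count_map -sum1_count -[in LHS]big_filter.
rewrite -sum1_card big_filter big_enum_cond /=.
by apply: eq_bigl => i; rewrite !inE.
Qed.

Lemma count_negb (s : seq bool) : count negb s = (size s - count id s)%N.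
Proof. by rewrite -(count_predC id s) addKn; apply: eq_count. Qed.

Lemma count_idD (s : seq bool) : (count id s + count negb s)%N = size s.
Proof. by rewrite count_negb subnKC// count_size. Qed.

Lemma bin2R (i : nat) : 'C(i, 2)%:R = (i ^_ 2)%:R / 2 :> R.
Proof. by rewrite -bin_ffact natrM mulfK// pnatr_eq0. Qed.

Lemma bin3R (i : nat) : 'C(i, 3)%:R = (i ^_ 3)%:R / 6 :> R.
Proof. by rewrite -bin_ffact natrM mulfK// pnatr_eq0. Qed.

Lemma Ex_vdist_sg s : Ex (vdist false s) sg =
  maj_num R (count id s) (count negb s) / ((count id s + count negb s) ^_ 3)%:R.
Proof.
rewrite count_idD.
rewrite /vdist; case: ifP => [|/negbT] /=.
  by move=> s3; rewrite Ex_ret (ffact_small s3) invr0 mulr0.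
rewrite -leqNgt => s3; rewrite Ex_bind Ex_uniform size_draws.
set U := [set i : 'I_(size s) | nth false s i].
set i := count id s; set j := count negb s.
have cU : #|U| = i by apply: count_ord.
have cC : #|~: U| = j by rewrite cardsCs setCK card_ord cU /j count_negb.
(* The sign depends only on the number r of ones among the three, so the sum over draws collapses to
   four hypergeometric counts. *)
pose sr (r : nat) : R := if (1 < r)%N then 1 else -1.
have -> : \sum_(S <- enum [set S : {set 'I_(size s)} | #|S| == 3%N])
   Ex (dret R (Some (majority [seq nth false s (nat_of_ord i) | i in S]))) sg =
   \sum_(r < 4) sr r * ('C(i, r) * 'C(j, 3 - r))%:R.
  rewrite big_enum /=.
  transitivity (\sum_(S in [set S : {set 'I_(size s)} | #|S| == 3%N])
      \sum_(r < 4) (sr r * (#|S :&: U| == r)%:R)).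
    apply: eq_bigr => S; rewrite inE => /eqP S3; rewrite Ex_ret.
    rewrite /majority size_map -cardE S3 count_image -/U.
    have le : (#|S :&: U| <= 3)%N by rewrite -S3 subset_leq_card// subsetIl.
    rewrite !big_ord_recr big_ord0 /= /sr.
    by case: (#|S :&: U|) le => [|[|[|[|?]]]] //= _; ring.
  rewrite exchange_big /=; apply: eq_bigr => r _; rewrite -mulr_sumr; congr (_ * _).
  have r3 : (r <= 3)%N by rewrite -ltnS.
  have := card_draws_meet U r3; rewrite cU cC => <-.
  rewrite -sum1dep_card natr_sum big_mkcondr /= [RHS]big_mkcond [LHS]big_mkcond /=.
  by apply: eq_bigr => S _; rewrite inE; case: (#|S| == 3%N) => //=; case: eqP.
have nz : ((size s) ^_ 3)%:R != 0 :> R by rewrite pnatr_eq0 -lt0n ffact_gt0.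
rewrite (bin3R (size s)); set K := ((size s) ^_ 3)%:R in nz *.
rewrite !big_ord_recr big_ord0 /= /sr /= !natrM !bin0 !bin1 !bin2R !bin3R.
rewrite /maj_num (natrM _ (i ^_ 2)) (natrM _ i (j ^_ 2)).
by field.
Qed.

Lemma Ex_vdist_sgB blk s : Ex (vdist blk s) sg = (~~ blk)%:R * Ex (vdist false s) sg.
Proof. by case: blk; rewrite ?mul1r// mul0r /vdist Ex_ret. Qed.

End Node.

(** * A round as balls thrown into inboxes *)

Section Balls.
Variables (R : realType) (n : nat).
Hypothesis n_gt0 : (0 < n)%N.
Implicit Types (x : seq (option bool)) (bs : seq bool) (v : 'I_n).

Definition unif : dist R 'I_n := duniform R (enum 'I_n).

Definition targets bs : dist R (seq 'I_n) := dseq (map (fun=> unif) bs).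

Definition inbox (r : seq (bool * 'I_n)) v : seq bool := [seq q.1 | q <- r & q.2 == v].

(** One entry per message, so that targets become independent per entry and bounded differences
    apply ball by ball. *)
Definition balls x : seq bool :=
  flatten [seq (if o is Some b then nseq 6 b else [::]) | o <- x].

Definition messages (r : seq (option bool * seq 'I_n)) : seq (bool * 'I_n) :=
  flatten [seq (if q.1 is Some b then [seq (b, t) | t <- q.2] else [::]) | q <- r].

Definition tdist (o : option bool) : dist R (seq 'I_n) :=
  if o is Some _
  then dbind (duniform R (enum {: 6.-tuple 'I_n})) (fun ts => dret R (val ts))
  else dret R [::].

Definition send x : dist R (config n) :=
  dbind (dseq (map tdist x)) (fun t => dret R (assemble (zip x t))).

Definition upd (B : {set 'I_n}) (c : config n) : dist R (seq (option bool)) :=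
  dseq [seq vdist R (u \in B) (c.2 u) | u <- enum 'I_n].

Definition upd_balls (B : {set 'I_n}) bs (w : seq 'I_n) : dist R (seq (option bool)) :=
  dseq [seq vdist R (u \in B) (inbox (zip bs w) u) | u <- enum 'I_n].

(** Markov kernel from the values after one update to those after the next. That [B] is a parameter,
    not a function of the throw, expresses the lateness of the adversary. *)
Definition kern (B : {set 'I_n}) x : dist R (seq (option bool)) :=
  dbind (targets (balls x)) (upd_balls B (balls x)).

Lemma isprob_unif : isprob unif.
Proof. by apply: isprob_uniform; rewrite -cardE card_ord. Qed.

Lemma isprob_targets bs : isprob (targets bs).
Proof. by apply: isprob_dseq => _; apply: isprob_unif. Qed.

Lemma isprob_tdist o : isprob (tdist o).
Proof.
case: o => [b|]; last exact: isprob_ret.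
apply: isprob_bind => [|t]; last exact: isprob_ret.
by apply: isprob_uniform; rewrite -cardE card_tuple card_ord expn_gt0 n_gt0.
Qed.

Lemma isprob_send x : isprob (send x).
Proof.
by apply: isprob_bind => [|t]; [apply: isprob_dseq => o; apply: isprob_tdist|apply: isprob_ret].
Qed.

Lemma isprob_upd B c : isprob (upd B c).
Proof. by apply: isprob_dseq => u; apply: isprob_vdist. Qed.

Lemma isprob_upd_balls B bs w : isprob (upd_balls B bs w).
Proof. by apply: isprob_dseq => u; apply: isprob_vdist. Qed.

Lemma isprob_kern B x : isprob (kern B x).
Proof. by apply: isprob_bind => [|w]; [apply: isprob_targets|apply: isprob_upd_balls]. Qed.

Lemma Ex_uniform_tuple k f :
  Ex (duniform R (enum {: k.-tuple 'I_n})) (fun ts => f (val ts)) =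
  Ex (dseq (nseq k unif)) f.
Proof.
rewrite Ex_uniform -cardE card_tuple card_ord big_enum /=.
elim: k f => [|k IH] f.
  rewrite Ex_dseq0 expn0 invr1 mul1r (big_pred1 [tuple]) //.
  by move=> t; apply/esym/eqP; rewrite [t]tuple0.
rewrite -[nseq k.+1 unif]/(unif :: nseq k unif) Ex_dseq_cons Ex_uniform -cardE card_ord.
rewrite big_enum /=.
under [in RHS]eq_bigr => a _ do rewrite -IH.
rewrite -mulr_sumr mulrA expnS natrM invfM; congr (_ * _).
rewrite pair_big /= (reindex (fun q : 'I_n * k.-tuple 'I_n => cons_tuple q.1 q.2)) /=.
  by apply: eq_bigl.
exists (fun t => (thead t, behead_tuple t)) => [[a t] _|t _] /=.
  by congr (_, _); apply: val_inj.
by apply: val_inj; rewrite /= [in RHS](tuple_eta t).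
Qed.

(** A uniform 6-tuple is six independent uniform targets, so sending node by node is the same as
    throwing the balls independently. *)
Lemma Ex_messages x G :
  Ex (dseq (map tdist x)) (fun t => G (messages (zip x t))) =
  Ex (targets (balls x)) (fun w => G (zip (balls x) w)).
Proof.
rewrite /targets; elim: x G => [|[b|] x IH] G.
- by rewrite !Ex_dseq0.
- have -> : balls (Some b :: x) = nseq 6 b ++ balls x by [].
  rewrite map_cat Ex_dseq_cat.
  rewrite [map tdist _]/= Ex_dseq_cons Ex_bind.
  under eq_Ex => ts.
    rewrite Ex_ret.
    under eq_Ex => t.
      rewrite /messages [zip _ _]/= [map _ _]/= [flatten _]/= -/(messages _).
      over.
    rewrite (IH (fun r => G ([seq (b, t) | t <- val ts] ++ r))).
    over.
  rewrite (Ex_uniform_tuple 6 (fun ts =>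
    Ex (dseq [seq unif | _ <- balls x]) (fun w => G ([seq (b, t) | t <- ts] ++ zip (balls x) w)))).
  have -> : [seq unif | _ <- nseq 6 b] = nseq 6 unif by [].
  apply: eq_Ex_dseq => r; rewrite size_nseq => r6.
  apply: eq_Ex => w; rewrite -[balls x in RHS]/(balls x) zip_cat ?size_nseq//.
  congr (G (_ ++ _)); rewrite -[in RHS]r6; elim: r {r6} => //= a r ->.
  by [].
- by rewrite [map tdist _]/= Ex_dseq_cons Ex_ret -IH.
Qed.

Lemma map_nth_enum T1 T2 (F : T1 -> T2) z (r : seq T1) : size r = n ->
  [seq F (nth z r (nat_of_ord u)) | u <- enum 'I_n] = map F r.
Proof.
move=> rn; rewrite (map_comp (fun k => F (nth z r k)) (@nat_of_ord n)) val_enum_ord.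
by rewrite -[in RHS](mkseq_nth z r) /mkseq -map_comp rn.
Qed.

Lemma assemble_inbox r v : size r = n -> (assemble r).2 v = inbox (messages r) v.
Proof.
move=> rn /=; rewrite (map_nth_enum (fun q : option bool * seq 'I_n =>
  match q.1 with Some b => [seq b | t <- q.2 & t == v] | None => [::] end) _ rn).
rewrite /inbox /messages filter_flatten map_flatten -!map_comp; congr flatten.
apply: eq_map => -[[b|] ts] //=.
by elim: ts => //= t ts; case: ifP => //= _ ->.
Qed.

Lemma assemble_val x (t : seq (seq 'I_n)) u : size x = n -> size t = n -> (assemble (zip x t)).1 u = nth None x u.
Proof. by move=> xn tn /=; rewrite nth_zip ?xn. Qed.

(** An update reads only the inboxes, never the stored values, so the configuration can be forgotten
    in favour of the balls. *)
Lemma Ex_send_upd B x F : size x = n -> Ex (send x) (fun c => Ex (upd B c) F) = Ex (kern B x) F.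
Proof.
move=> xn; rewrite !Ex_bind.
rewrite -(Ex_messages x (fun r => Ex (dseq [seq vdist R (u \in B) (inbox r u) | u <- enum 'I_n]) F)).
apply: eq_Ex_dseq => t; rewrite size_map => tx; rewrite Ex_ret /upd.
congr (Ex (dseq _) F); apply: eq_map => u; rewrite assemble_inbox//.
by rewrite size_zip tx minnn.
Qed.

Lemma Ex_round B c H : Ex (round R 6 3 B c) H = Ex (upd B c) (fun x => Ex (send x) H).
Proof.
rewrite /round Ex_bind /upd.
rewrite (@eq_dseq_Ex _ _ _ _ _ (fun u => dbind (vdist R (u \in B) (c.2 u))
   (fun o => dbind (tdist o) (fun t => dret R (o, t))))).
  rewrite Ex_dseq_pair; apply: eq_Ex => x; rewrite Ex_bind.
  by apply: eq_Ex => t; rewrite !Ex_ret.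
move=> u h; rewrite /node_step /vdist; case: ifP => _.
  by rewrite Ex_ret !Ex_bind !Ex_ret Ex_bind !Ex_ret.
rewrite !Ex_bind; apply: eq_Ex => S; rewrite Ex_ret !Ex_bind; apply: eq_Ex => t.
by rewrite !Ex_ret.
Qed.

Lemma Ex_dseq_ret A I (s : seq I) (g : I -> A) H :
  Ex (dseq [seq dret R (g i) | i <- s]) H = H (map g s).
Proof.
by elim: s H => [|i s IH] H; rewrite ?Ex_dseq0// Ex_dseq_cons Ex_ret IH.
Qed.

Lemma Ex_init (x0 : 'I_n -> bool) H : Ex (init_config R 6 x0) H = Ex (send [seq Some (x0 u) | u <- enum 'I_n]) H.
Proof.
rewrite /init_config Ex_bind.
rewrite (@eq_dseq_Ex _ _ _ _ _ (fun u => dbind (dret R (Some (x0 u)))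
   (fun o => dbind (tdist o) (fun t => dret R (o, t))))).
  rewrite Ex_dseq_pair Ex_dseq_ret Ex_bind.
  by apply: eq_Ex => t; rewrite !Ex_ret.
move=> u h; rewrite !Ex_bind Ex_ret !Ex_bind; apply: eq_Ex => t.
by rewrite !Ex_ret.
Qed.

Lemma Ex_send_val x (f : config n -> R) (g : R) : size x = n ->
  (forall c : config n, (forall u : 'I_n, c.1 u = nth None x u) -> f c = g) -> Ex (send x) f = g.
Proof.
move=> xn fg; rewrite Ex_bind (@eq_Ex_dseq _ _ _ _ (fun=> g)).
  by rewrite Ex_cst//; apply: isprob_dseq => o; apply: isprob_tdist.
move=> t; rewrite size_map xn => tn; rewrite Ex_ret; apply: fg => u.
exact: assemble_val.
Qed.

End Balls.

(** * Mean, variance and fourth moment of one transition *)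

Section Step.
Variables (R : realType) (n : nat).
Hypothesis n_gt0 : (0 < n)%N.
Variable B : {set 'I_n}.
Implicit Types (bs : seq bool) (v : 'I_n).

Lemma inbox_zip_neq bs r1 r2 (a a' v : 'I_n) : a != v -> a' != v ->
  inbox (zip bs (r1 ++ a :: r2)) v = inbox (zip bs (r1 ++ a' :: r2)) v.
Proof.
move=> av a'v; elim: r1 bs => [|t r1 IH] [|b bs] //=; rewrite /inbox /=.
  by rewrite (negbTE av) (negbTE a'v).
by case: ifP => _ /=; rewrite -!/(inbox _ _) IH.
Qed.

Lemma inbox_cons b t r v :
  inbox ((b, t) :: r) v = if t == v then b :: inbox r v else inbox r v.
Proof. by rewrite /inbox /=; case: ifP. Qed.

Definition inbox_sum (psi : bool -> seq bool -> R) bs (w : seq 'I_n) : R :=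
  \sum_(u <- enum 'I_n) psi (u \in B) (inbox (zip bs w) u).

(** Redirecting one ball alters only the inboxes of its old and its new target, and each of the two
    terms moves by at most 2. *)
Lemma bdiff_inbox_sum psi bs :
  (forall b s, `|psi b s| <= 1) -> bdiff 4 (inbox_sum psi bs).
Proof.
move=> psi1 r1 a a' r2; rewrite /inbox_sum -sumrN -big_split /=.
apply: le_trans (ler_norm_sum _ _ _) _.
apply: (@le_trans _ _ (\sum_(u <- enum 'I_n) (2 * (a == u)%:R + 2 * (a' == u)%:R))).
  apply: ler_sum => u _.
  have h1 := psi1 (u \in B) (inbox (zip bs (r1 ++ a :: r2)) u).
  have h2 := psi1 (u \in B) (inbox (zip bs (r1 ++ a' :: r2)) u).
  have h : `|psi (u \in B) (inbox (zip bs (r1 ++ a :: r2)) u) -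
             psi (u \in B) (inbox (zip bs (r1 ++ a' :: r2)) u)| <= 2.
    by apply: le_trans (ler_normB _ _) _; lra.
  have [_|au] := boolP (a == u); first by apply: le_trans h _; case: (a' == u) => /=; lra.
  have [_|a'u] := boolP (a' == u); first by apply: le_trans h _; rewrite /=; lra.
  by rewrite (inbox_zip_neq _ _ _ au a'u) subrr normr0 /=; lra.
rewrite big_enum big_split -!mulr_sumr /=.
have one c : \sum_(i in 'I_n) (c == i)%:R = 1 :> R.
  rewrite (bigD1 c) //= eqxx big1 ?addr0// => i; rewrite eq_sym => /negbTE ->.
  by [].
rewrite !one; lra.
Qed.

Lemma Ex_unif_eq v (X Y : R) :
  Ex (unif R n) (fun t => if t == v then X else Y) = n%:R^-1 * X + (1 - n%:R^-1) * Y.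
Proof.
transitivity (Ex (unif R n) (fun t => Y + (X - Y) * (t == v)%:R)).
  by apply: eq_Ex => t; case: (t == v) => /=; ring.
rewrite ExD ExZ Ex_cst; last exact: isprob_unif.
rewrite Ex_uniform -cardE card_ord big_enum /= (bigD1 v) //= eqxx big1 ?addr0.
  by rewrite mulr1; ring.
by move=> i /negbTE ->.
Qed.

(** Each ball hits [v] independently with probability 1/n, so the ones and the zeros received by [v]
    are independent binomials. *)
Lemma Ex_inbox bs v (F : nat -> nat -> R) :
  Ex (targets R n bs) (fun w => F (count id (inbox (zip bs w) v)) (count negb (inbox (zip bs w) v)))
  = bn n%:R^-1 (count id bs) (fun i => bn n%:R^-1 (count negb bs) (fun j => F i j)).
Proof.
rewrite /targets; elim: bs F => [|b bs IH] F; first by rewrite Ex_dseq0.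
rewrite [map _ _]/= Ex_dseq_cons.
set p := n%:R^-1 in IH *.
under eq_Ex => t.
  under eq_Ex => w do rewrite [zip _ _]/= inbox_cons.
  over.
transitivity (Ex (unif R n) (fun t => if t == v
  then bn p (count id bs) (fun i => bn p (count negb bs) (fun j => F (b + i)%N (~~ b + j)%N))
  else bn p (count id bs) (fun i => bn p (count negb bs) (fun j => F i j)))).
  apply: eq_Ex => t; case: (t == v) => //=; last exact: IH.
rewrite Ex_unif_eq -/p; case: b => //=.
by rewrite bnD !bnZ.
Qed.

Definition delta (x : seq (option bool)) : R := \sum_(o <- x) sg R o.
Definition ndef (x : seq (option bool)) : R := \sum_(o <- x) defd R o.

Definition nfree : R := #|~: B|%:R.

Lemma sum_free (c : R) : \sum_(u <- enum 'I_n) (u \notin B)%:R * c = nfree * c.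
Proof.
rewrite -mulr_suml big_enum /=; congr (_ * _).
rewrite /nfree -sum1_card natr_sum [RHS]big_mkcond /=.
by apply: eq_bigr => u _; rewrite inE; case: (u \in B).
Qed.

Definition psi_sg (b : bool) (s : seq bool) : R := Ex (vdist R b s) (sg R).
Definition psi_def (b : bool) (s : seq bool) : R := Ex (vdist R b s) (defd R).

Lemma psi_sg_norm b s : `|psi_sg b s| <= 1.
Proof. by apply: norm_Ex_le; [apply: isprob_vdist|apply: sg_norm]. Qed.

Lemma psi_def_norm b s : `|psi_def b s| <= 1.
Proof. by rewrite /psi_def Ex_vdist_defd; case: (_ && _); rewrite ?normr1 ?normr0 ?ler01. Qed.

Lemma mean_inbox_def bs :
  Ex (targets R n bs) (inbox_sum psi_def bs) =
  nfree * bn n%:R^-1 (size bs) (fun m => (2 < m)%N%:R).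
Proof.
rewrite /inbox_sum Ex_sum -sum_free; apply: eq_bigr => u _.
transitivity (Ex (targets R n bs) (fun w => (u \notin B)%:R *
   (fun i j => (2 < i + j)%N%:R) (count id (inbox (zip bs w) u)) (count negb (inbox (zip bs w) u)))).
  by apply: eq_Ex => w; rewrite /psi_def Ex_vdist_defd count_idD; case: (u \in B) => /=; rewrite ?mul0r ?mul1r.
rewrite ExZ (Ex_inbox bs u (fun i j => (2 < i + j)%N%:R)).
by rewrite (bn_add _ _ _ (fun m => (2 < m)%N%:R)) count_idD.
Qed.

Lemma mean_inbox_sg bs :
  Ex (targets R n bs) (inbox_sum psi_sg bs) =
  nfree * bn n%:R^-1 (count id bs) (fun i => bn n%:R^-1 (count negb bs)
    (fun j => maj_num R i j / ((i + j) ^_ 3)%:R)).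
Proof.
rewrite /inbox_sum Ex_sum -sum_free; apply: eq_bigr => u _.
rewrite -(Ex_inbox bs u (fun i j => maj_num R i j / ((i + j) ^_ 3)%:R)) -ExZ.
by apply: eq_Ex => w; rewrite /psi_sg Ex_vdist_sgB Ex_vdist_sg.
Qed.

Lemma Ex_upd_delta bs w : Ex (upd_balls R B bs w) delta = inbox_sum psi_sg bs w.
Proof. by rewrite Ex_dseq_sum// => u; apply: isprob_vdist. Qed.

Lemma Ex_kern_delta x :
  Ex (kern R B x) delta = Ex (targets R n (balls x)) (inbox_sum psi_sg (balls x)).
Proof. by rewrite Ex_bind; apply: eq_Ex => w; rewrite Ex_upd_delta. Qed.

Lemma bdiff_delta : bdiff 2 delta.
Proof.
move=> r1 a a' r2; rewrite /delta !big_cat !big_cons /=.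
have -> : forall u v w z : R, u + (v + w) - (u + (z + w)) = v - z by move=> *; ring.
apply: le_trans (ler_normB _ _) _.
have := sg_norm R a; have := sg_norm R a'; lra.
Qed.

(** Given the targets, which nodes become defined is deterministic; only the throw fluctuates, and
    16 is the squared difference 4. *)
Lemma kern_ndef_variance x :
  Ex (kern R B x) (fun y => (ndef y - nfree * bn n%:R^-1 (size (balls x)) (fun m => (2 < m)%N%:R)) ^+ 2)
  <= 16 * (size (balls x))%:R.
Proof.
rewrite Ex_bind; set bs := balls x.
rewrite -mean_inbox_def; set c := Ex _ (inbox_sum _ _).
have [V _] := @bdiff_moments R _ 4 _ bs (fun=> unif R n) (inbox_sum psi_def bs)
  (fun=> isprob_unif R n_gt0) (bdiff_inbox_sum bs psi_def_norm).
apply: le_trans (_ : _ <= (size bs)%:R * 4 ^+ 2) _; last by rewrite expr2; lra.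
apply: le_trans V; apply: ler_Ex; first exact: isprob_targets.
move=> w.
have kp (u : 'I_n) : isprob (vdist R (u \in B) (inbox (zip bs w) u)) by apply: isprob_vdist.
rewrite (@eq_Ex _ _ _ _ (fun y => ((inbox_sum psi_def bs w - c) +
   (ndef y - inbox_sum psi_def bs w)) ^+ 2)); last by move=> y; congr (_ ^+ 2); ring.
rewrite Ex_sqr_shift; first last.
- by rewrite ExD Ex_dseq_sum// Ex_cst ?subrr//; apply: isprob_upd_balls.
- exact: isprob_upd_balls.
rewrite variance_dseq_sum// big1 ?addr0// => u _.
rewrite (@eq_Ex _ _ _ _ (defd R)).
  by rewrite Ex_vdist_defd; case: (_ && _); rewrite ?expr1n ?expr0n subrr.
by move=> o; rewrite /defd; case: isSome; rewrite ?expr1n ?expr0n.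
Qed.

(** Law of total variance, conditioning on the targets: given these the nodes update independently,
    and the square of [sg] is [defd]. *)
Lemma kern_delta_sqr x : let mu := Ex (kern R B x) delta in
  Ex (kern R B x) (fun y => (delta y - mu) ^+ 2) =
  Ex (targets R n (balls x)) (fun w => (inbox_sum psi_sg (balls x) w - mu) ^+ 2) +
  Ex (targets R n (balls x)) (inbox_sum (fun b s => psi_def b s - psi_sg b s ^+ 2) (balls x)).
Proof.
move=> mu; rewrite Ex_bind -ExD; apply: eq_Ex => w; set bs := balls x.
transitivity (Ex (upd_balls R B bs w) (fun y => ((inbox_sum psi_sg bs w - mu) +
   (delta y - inbox_sum psi_sg bs w)) ^+ 2)).
  by apply: eq_Ex => y; congr (_ ^+ 2); ring.
have kp (u : 'I_n) : isprob (vdist R (u \in B) (inbox (zip bs w) u)) by apply: isprob_vdist.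
rewrite Ex_sqr_shift; first last.
- by rewrite ExD Ex_dseq_sum// Ex_cst ?subrr//; apply: isprob_upd_balls.
- exact: isprob_upd_balls.
rewrite variance_dseq_sum//; congr (_ + _); apply: eq_bigr => u _.
by congr (_ - _); apply: eq_Ex => o; rewrite sg_sqr.
Qed.

Lemma kern_delta_sqr_le x :
  Ex (kern R B x) (fun y => (delta y - Ex (kern R B x) delta) ^+ 2) <= n%:R + 16 * (size (balls x))%:R.
Proof.
set mu := Ex (kern R B x) delta; rewrite kern_delta_sqr; cbv zeta; rewrite -/mu addrC; apply: lerD.
  apply: Ex_le; first exact: isprob_targets.
  move=> w; rewrite /inbox_sum; apply: (@le_trans _ _ (\sum_(u <- enum 'I_n) 1)).
    apply: ler_sum => u _; rewrite lerBlDr.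
    by apply: le_trans (ler_norm _) (le_trans (psi_def_norm _ _) _); rewrite lerDl sqr_ge0.
  by rewrite big_enum /= sumr_const card_ord.
have [V _] := @bdiff_moments R _ 4 _ (balls x) (fun=> unif R n) (inbox_sum psi_sg (balls x))
  (fun=> isprob_unif R n_gt0) (bdiff_inbox_sum (balls x) psi_sg_norm).
rewrite -/(targets R n (balls x)) -Ex_kern_delta -/mu in V.
by apply: le_trans V _; rewrite expr2; lra.
Qed.

(* An inbox with two ones and two zeros makes its node a fair coin. *)
Lemma kern_delta_sqr_ge x :
  nfree * bn n%:R^-1 (count id (balls x)) (fun i => bn n%:R^-1 (count negb (balls x))
    (fun j => (i == 2)%N%:R * (j == 2)%N%:R))
  <= Ex (kern R B x) (fun y => (delta y - Ex (kern R B x) delta) ^+ 2).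
Proof.
set mu := Ex (kern R B x) delta; rewrite kern_delta_sqr; cbv zeta; rewrite -/mu; set bs := balls x.
rewrite -[leLHS]add0r; apply: lerD.
  by apply: Ex_ge0 => [|w]; [apply: isprob_targets|apply: sqr_ge0].
rewrite -(sum_free (bn _ _ _)) /inbox_sum Ex_sum; apply: ler_sum => u _.
rewrite -(Ex_inbox bs u (fun i j => (i == 2)%N%:R * (j == 2)%N%:R)) -ExZ.
apply: ler_Ex; first exact: isprob_targets.
move=> w; set s := inbox _ _.
have ge0 : 0 <= psi_def (u \in B) s - psi_sg (u \in B) s ^+ 2.
  rewrite subr_ge0 /psi_def (@eq_Ex _ _ _ _ (fun o => sg R o ^+ 2)) => [|o].
    by apply: Ex_sqr_ge; apply: isprob_vdist.
  by rewrite sg_sqr.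
have [i2|_] := eqVneq (count id s) 2%N; last by rewrite mul0r mulr0.
have [j2|_] := eqVneq (count negb s) 2%N; last by rewrite !mulr0.
rewrite /psi_sg Ex_vdist_sgB Ex_vdist_sg maj_numE i2 j2 subrr !mul0r mulr0 expr0n subr0.
rewrite /psi_def Ex_vdist_defd -count_idD i2 j2 !mulr1.
by case: (u \in B).
Qed.

(** The throw has differences 4 and the update given the throw has differences 2. With (a + b)^4 <=
    8 a^4 + 8 b^4 the constants are 8 * 4 * 2^4 = 512 and 8 * 4 * 4^4 = 8192. *)
Lemma kern_delta_fourth x :
  Ex (kern R B x) (fun y => (delta y - Ex (kern R B x) delta) ^+ 4) <=
  512 * n%:R ^+ 2 + 8192 * (size (balls x))%:R ^+ 2.
Proof.
set mu := Ex (kern R B x) delta; set bs := balls x; set S := inbox_sum psi_sg bs.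
have [_ V] := @bdiff_moments R _ 4 _ bs (fun=> unif R n) S
  (fun=> isprob_unif R n_gt0) (bdiff_inbox_sum bs psi_sg_norm).
rewrite -/(targets R n bs) -Ex_kern_delta -/mu in V.
rewrite Ex_bind.
apply: (@le_trans _ _ (Ex (targets R n bs) (fun w => 8 * (S w - mu) ^+ 4 + 512 * n%:R ^+ 2))).
  apply: ler_Ex; first exact: isprob_targets.
  move=> w.
  have kp (u : 'I_n) : isprob (vdist R (u \in B) (inbox (zip bs w) u)) by apply: isprob_vdist.
  have [_ W] := bdiff_moments (enum 'I_n) kp bdiff_delta.
  rewrite -/(upd_balls R B bs w) Ex_upd_delta -/S -cardE card_ord in W.
  apply: (@le_trans _ _ (Ex (upd_balls R B bs w) (fun y => 8 * (S w - mu) ^+ 4 + 8 * (delta y - S w) ^+ 4))).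
    apply: ler_Ex => [|y]; first exact: isprob_upd_balls.
    have -> : delta y - mu = (S w - mu) + (delta y - S w) by ring.
    set a := S w - mu; set b := delta y - S w.
    have -> : 8 * a ^+ 4 + 8 * b ^+ 4 = (a + b) ^+ 4 + (a - b) ^+ 2 * ((a - b) ^+ 2 + 6 * (a + b) ^+ 2)
       by ring.
    have h1 := sqr_ge0 (a - b); have h2 := sqr_ge0 (a + b).
    have h4 : 0 <= (a - b) ^+ 2 * ((a - b) ^+ 2 + 6 * (a + b) ^+ 2) by rewrite mulr_ge0//; lra.
    lra.
  rewrite ExD Ex_cst; last exact: isprob_upd_balls.
  rewrite lerD2l (ExZ _ 8 (fun y => (delta y - S w) ^+ 4)).
  have -> : 512 * n%:R ^+ 2 = 8 * (4 * n%:R ^+ 2 * 2 ^+ 4) :> R by ring.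
  by rewrite ler_pM2l.
rewrite ExD Ex_cst; last exact: isprob_targets.
rewrite addrC lerD2l (ExZ _ 8 (fun w => (S w - mu) ^+ 4)).
have -> : 8192 * (size bs)%:R ^+ 2 = 8 * (4 * (size bs)%:R ^+ 2 * 4 ^+ 4) :> R by ring.
by rewrite ler_pM2l.
Qed.

End Step.

(** * Numerical estimates *)

Section Estimates.
Variable R : realType.

Lemma expRN1_le : expR (-1) <= 371 / 1000 :> R.
Proof.
have e1 : 65 / 24 <= expR 1 :> R.
  have -> : 65 / 24 = series (exp_coeff (1 : R)) 5.
    rewrite /series /= 5?big_nat_recr//= big_nil /exp_coeff /= !expr1n.
    have -> : 4`! = 24%N by []. have -> : 3`! = 6%N by [].
    have -> : 2`! = 2%N by []. have -> : 1`! = 1%N by [].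
    by rewrite fact0; lra.
  apply: nondecreasing_cvgn_le; last exact: is_cvg_series_exp_coeff.
  by apply/nondecreasing_seqP => k; rewrite seriesSr lerDl /exp_coeff divr_ge0// expr1n.
rewrite expRN -[leRHS]invrK lef_pV2 ?posrE ?expR_gt0//; lra.
Qed.

Section Powers.
Variable n : nat.
Hypothesis n_ge : (1000 <= n)%N.
Let p : R := n%:R^-1.

Lemma nR_ge : 1000 <= n%:R :> R. Proof. by rewrite ler_nat. Qed.

Lemma p_bounds : 0 < p <= 1 / 1000.
Proof.
have nR := nR_ge; have n0 : 0 < n%:R :> R by lra.
by rewrite /p invr_gt0 n0 div1r lef_pV2 ?posrE//; lra.
Qed.

Lemma np1 : n%:R * p = 1.
Proof. by rewrite /p divff//; have := nR_ge; lra. Qed.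

Lemma p01 : 0 <= p <= 1.
Proof. have := p_bounds; lra. Qed.

Lemma pow_n_le : (1 - p) ^+ n <= 371 / 1000.
Proof.
apply: le_trans expRN1_le.
have -> : -1 = n%:R * (- p) :> R by rewrite mulrN np1.
rewrite expRM_natl lerXn2r ?nnegrE ?expR_ge0//; first by have := p01; lra.
by apply: le_trans (expR_ge1Dx _).
Qed.

(** From 1 - p >= exp(-2p), valid for small p; the spare factor 2 turns the exponent -6 into -12. *)
Lemma pow_6n_ge : expR (-12) <= (1 - p) ^+ (6 * n).
Proof.
have p1 := p_bounds.
have h : expR (- (2 * p)) <= 1 - p.
  rewrite expRN -div1r ler_pdivrMr ?expR_gt0//.
  apply: (@le_trans _ _ ((1 - p) * (1 + 2 * p))); first by nra.
  by apply: ler_wpM2l; [lra|apply: expR_ge1Dx].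
apply: le_trans (_ : expR (- (2 * p)) ^+ (6 * n) <= _); last first.
  by rewrite lerXn2r ?nnegrE ?expR_ge0//; lra.
rewrite -expRM_natr ler_expR natrM.
have := np1; lra.
Qed.

(** The Poisson value exp(-k) (1 + k + k^2/2), with 371/1000 in place of exp(-1). The factor
    1003/1000 absorbs the (1 - p)^(-2) left by the exponent [M - 2]. *)
Lemma bn_lt3_le (k : nat) (c e : R) :
  (0 < k)%N -> 1 + k%:R + k%:R ^+ 2 / 2 <= c -> (371 / 1000) ^+ k * c * (1003 / 1000) <= e ->
  bn p (k * n) (fun i => (i < 3)%N%:R) <= e.
Proof.
move=> k0 kc ke; have p1 := p_bounds; have [p0 _] := andP p1.
rewrite bn_lt3; set M := (k * n)%N.
have M2 : (2 <= M)%N by rewrite (leq_trans _ (leq_pmull n k0))// (leq_trans _ n_ge).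
set y := (1 - p) ^+ (M - 2).
have y0 : 0 <= y by rewrite exprn_ge0//; lra.
have e1 : (1 - p) ^+ (M - 1) = (1 - p) * y by rewrite /y -exprS -subSn// subSS.
have e0 : (1 - p) ^+ M = (1 - p) ^+ 2 * y by rewrite /y -exprD subnKC.
have yk : (1 - p) ^+ 2 * y <= (371 / 1000) ^+ k.
  rewrite -e0 /M mulnC exprM lerXn2r ?nnegrE//; last exact: pow_n_le.
    by rewrite exprn_ge0//; lra.
  by lra.
have Mp : M%:R * p = k%:R by rewrite natrM -mulrA np1 mulr1.
rewrite e1 e0 bin2R ffact2R Mp.
set K : R := k%:R in kc Mp *.
have K1 : 1 <= K by rewrite /K ler1n.
have -> : M%:R * (M%:R - 1) / 2 * p ^+ 2 = K * (K - p) / 2 by rewrite -Mp; field.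
have y1 : y <= (371 / 1000) ^+ k * (1003 / 1000).
  apply: le_trans (_ : (1 - p) ^+ 2 * y * (1003 / 1000) <= _); last by apply: ler_wpM2r yk; lra.
  suff : 0 <= y * ((1 - p) ^+ 2 * (1003 / 1000) - 1) by lra.
  by apply: mulr_ge0 => //; nra.
have c0 : 0 <= c by apply: le_trans kc; nra.
apply: (@le_trans _ _ (y * c)); last first.
  by apply: le_trans (ler_wpM2r c0 y1) _; rewrite mulrAC.
apply: (@le_trans _ _ (y * (1 + K + K ^+ 2 / 2))); last exact: ler_wpM2l.
have -> : (1 - p) ^+ 2 * y + K * ((1 - p) * y) + K * (K - p) / 2 * y =
  y * ((1 - p) ^+ 2 + K * (1 - p) + K * (K - p) / 2) by field.
by apply: ler_wpM2l => //; nra.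
Qed.

(** Two thirds of the nodes being defined means at least 4n balls; the next lemma serves the case of
    five sixths, with 5n balls. *)
Lemma bn_lt3_4n (M : nat) : (4 * n <= M)%N -> bn p M (fun i => (i < 3)%N%:R) <= 1 / 4.
Proof.
move=> le; apply: le_trans (bn_lt3_anti p01 le) _.
by apply: (@bn_lt3_le 4 13) => //; lra.
Qed.

Lemma bn_lt3_5n (M : nat) : (5 * n <= M)%N -> bn p M (fun i => (i < 3)%N%:R) <= 7 / 50.
Proof.
move=> le; apply: le_trans (bn_lt3_anti p01 le) _.
by apply: (@bn_lt3_le 5 (37 / 2)) => //; lra.
Qed.

Lemma bn_gt2 (M : nat) :
  bn p M (fun i => (2 < i)%N%:R) = 1 - bn p M (fun i => (i < 3)%N%:R).
Proof.
suff : bn p M (fun i => (2 < i)%N%:R) + bn p M (fun i => (i < 3)%N%:R) = 1.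
  by move=> h; apply/eqP; rewrite eq_sym subr_eq; apply/eqP.
rewrite -bnD; transitivity (bn p M (fun=> 1)); last exact: bn_cst.
apply: eq_bn => i; have -> : (i < 3)%N = ~~ (2 < i)%N by rewrite -leqNgt.
by case: (2 < i)%N => /=; rewrite ?addr0 ?add0r.
Qed.

End Powers.

(** The inequality behind the growth factor 11/10, doubled because [mu_lower] carries
    [2 * ndef R x ^+ 3]. The bound Q >= 3/4 alone fails at d = N, whence the split at d = 5N/6,
    beyond which the extra balls give Q >= 43/50. *)
Lemma growth_poly (N d Q K Y : R) : 0 < N -> 2 / 3 * N <= d <= N ->
  3 / 4 <= Q -> (5 / 6 * N <= d -> 43 / 50 <= Q) -> 15 / 16 * N * Q <= K ->
  0 <= Y <= 2 / 5 * N -> 11 / 5 * d ^+ 3 <= K * (3 * d ^+ 2 - Y ^+ 2).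
Proof.
move=> N0 /andP[d1 d2] Q1 Q2 KQ /andP[Y0 Y1].
have Y2 : Y ^+ 2 <= 4 / 25 * N ^+ 2.
  have -> : 4 / 25 * N ^+ 2 = (2 / 5 * N) ^+ 2 by field.
  by rewrite lerXn2r ?nnegrE//; lra.
have dd : 4 / 9 * N ^+ 2 <= d ^+ 2.
  have -> : 4 / 9 * N ^+ 2 = (2 / 3 * N) ^+ 2 by field.
  by rewrite lerXn2r ?nnegrE//; lra.
have P0 : 0 <= 3 * d ^+ 2 - Y ^+ 2 by have := sqr_ge0 N; lra.
have [d56|d56] := lerP d (5 / 6 * N).
  apply: le_trans (_ : 45 / 64 * N * (3 * d ^+ 2 - Y ^+ 2) <= _); last first.
    by apply: ler_wpM2r => //; nra.
  (* Products of the interval constraints turn the cubic inequality into a linear combination. *)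
  have h1 : 0 <= (d - 2 / 3 * N) * (5 / 6 * N - d) * d by rewrite !mulr_ge0//; lra.
  have h2 : 0 <= (d - 2 / 3 * N) * (5 / 6 * N - d) * N by rewrite !mulr_ge0//; lra.
  have h3 : 0 <= (d - 2 / 3 * N) * N * N by rewrite !mulr_ge0//; lra.
  have h4 : 0 <= (5 / 6 * N - d) * N * N by rewrite !mulr_ge0//; lra.
  have h5 : N * Y ^+ 2 <= N * (4 / 25 * N ^+ 2) by apply: ler_wpM2l => //; lra.
  have h6 : 0 <= N * N * N by rewrite !mulr_ge0//; lra.
  lra.
apply: le_trans (_ : 129 / 160 * N * (3 * d ^+ 2 - Y ^+ 2) <= _); last first.
  by apply: ler_wpM2r => //; have := Q2 (ltW d56); nra.
have h1 : 0 <= (d - 5 / 6 * N) * (N - d) * d by rewrite !mulr_ge0//; lra.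
have h2 : 0 <= (d - 5 / 6 * N) * (N - d) * N by rewrite !mulr_ge0//; lra.
have h3 : 0 <= (d - 5 / 6 * N) * N * N by rewrite !mulr_ge0//; lra.
have h4 : 0 <= (N - d) * N * N by rewrite !mulr_ge0//; lra.
have h5 : N * Y ^+ 2 <= N * (4 / 25 * N ^+ 2) by apply: ler_wpM2l => //; lra.
have h6 : 0 <= N * N * N by rewrite !mulr_ge0//; lra.
lra.
Qed.

End Estimates.

(** * Contraction of the potential for an abstract random variable *)

Section Potential.
Variable R : realType.

(** Write 1 + e Y^2 = Q + s with s = e (2 mu D + D^2) and D the deviation. As Q + s >= 1, (Q - s +
    s^2)(Q + s) = Q^2 + s^2 (Q + s - 1) >= Q^2, so 1/(Q + s) <= (Q - s + s^2)/Q^2. In expectation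
    the linear term gains e V, and s^2 costs at most 8 e^2 mu^2 V plus a fourth moment term of at
    most e V / 4. *)
Lemma potential_step A (d : dist R A) (Y : A -> R) (mu y e al : R) :
  isprob d -> mu = Ex d Y -> 0 <= e -> 0 <= al ->
  let V := Ex d (fun a => (Y a - mu) ^+ 2) in
  al <= e * V -> e * V <= 1 / 2000 ->
  e ^+ 2 * Ex d (fun a => (Y a - mu) ^+ 4) <= e * V / 8 ->
  121 / 100 * y ^+ 2 <= mu ^+ 2 ->
  Ex d (fun a => (1 + e * Y a ^+ 2)^-1) <= (1 - al / 5) * (1 + e * y ^+ 2)^-1.
Proof.
move=> dp muE e0 al0 V alV Vs; set W := Ex d _ => WV ymu.
set Q := 1 + e * mu ^+ 2.
have eu : 0 <= e * mu ^+ 2 by rewrite mulr_ge0 ?sqr_ge0.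
have ey : 0 <= e * y ^+ 2 by rewrite mulr_ge0 ?sqr_ge0.
have Q1 : 1 <= Q by rewrite /Q; lra.
have Q0 : 0 < Q by lra.
have Q20 : 0 < Q ^+ 2 by rewrite exprn_gt0.
have V0 : 0 <= V by apply: Ex_ge0 => // a; apply: sqr_ge0.
apply: (@le_trans _ _ (Q ^- 2 * (Q - e * V + 8 * (e * mu ^+ 2) * (e * V) + 2 * (e ^+ 2 * W)))).
  apply: (@le_trans _ _ (Ex d (fun a => Q ^- 2 * (Q + (- 2 * e * mu) * (Y a - mu)
     + (8 * e ^+ 2 * mu ^+ 2 - e) * (Y a - mu) ^+ 2 + (2 * e ^+ 2) * (Y a - mu) ^+ 4)))).
    apply: ler_Ex => // a; set D := Y a - mu.
    have -> : Y a = mu + D by rewrite /D; ring.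
    set s := e * (2 * mu * D + D ^+ 2).
    have E1 : 1 + e * (mu + D) ^+ 2 = Q + s by rewrite /Q /s; ring.
    have S1 : 1 <= Q + s by rewrite -E1 lerDl mulr_ge0 ?sqr_ge0.
    rewrite E1 mulrC -div1r ler_pdivlMr// mulrC mulrA mulr1 ler_pdivrMr; last by lra.
    have s2 : s ^+ 2 <= e ^+ 2 * (8 * mu ^+ 2 * D ^+ 2 + 2 * D ^+ 4).
      rewrite /s exprMn; apply: ler_wpM2l; first exact: sqr_ge0.
      have := sqr_ge0 (2 * mu * D - D ^+ 2).
      have -> : (2 * mu * D - D ^+ 2) ^+ 2 = 2 * (4 * mu ^+ 2 * D ^+ 2 + D ^+ 4) -
        (2 * mu * D + D ^+ 2) ^+ 2 by ring.
      by lra.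
    have h : Q - s + s ^+ 2 <= Q + - 2 * e * mu * D + (8 * e ^+ 2 * mu ^+ 2 - e) * D ^+ 2 + 2 * e ^+ 2 * D ^+ 4.
      by apply: le_trans (_ : Q - s + e ^+ 2 * (8 * mu ^+ 2 * D ^+ 2 + 2 * D ^+ 4) <= _); rewrite ?lerD2l// /s le_eqVlt; apply/orP; left; apply/eqP; ring.
    apply: (@le_trans _ _ ((Q - s + s ^+ 2) * (Q + s))); last by apply: ler_wpM2r => //; lra.
    have : 0 <= s ^+ 2 * (Q + s - 1) by rewrite mulr_ge0 ?sqr_ge0//; lra.
    by lra.
  rewrite ExZ !ExD !Ex_cst// (ExZ _ (- 2 * e * mu) (fun a => Y a - mu)).
  rewrite (ExZ _ (8 * e ^+ 2 * mu ^+ 2 - e) (fun a => (Y a - mu) ^+ 2)) -/V.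
  rewrite (ExZ _ (2 * e ^+ 2) (fun a => (Y a - mu) ^+ 4)) -/W.
  have -> : Ex d (fun a => Y a - mu) = 0 by rewrite muE Ex_centered.
  rewrite le_eqVlt; apply/orP; left; apply/eqP; congr (_ * _); rewrite /Q; ring.
rewrite mulrC ler_pdivrMr// [leRHS]mulrAC ler_pdivlMr; last by lra.
set P := e * V in alV Vs WV *; set u := e * mu ^+ 2 in eu Q Q1 Q0 Q20 *.
have yu : 121 / 100 * (e * y ^+ 2) <= u by rewrite mulrCA /u ler_wpM2l.
set z := e * y ^+ 2 in ey yu *.
have P0 : 0 <= P by rewrite mulr_ge0.
apply: (@le_trans _ _ ((Q - 3 / 4 * P + 8 * u * P) * (1 + 100 / 121 * u))).
  apply: (@le_trans _ _ ((Q - 3 / 4 * P + 8 * u * P) * (1 + z))).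
    by apply: ler_wpM2r; lra.
  by apply: ler_wpM2l; [have : 0 <= u * P by exact: mulr_ge0|]; lra.
apply: (@le_trans _ _ ((1 - P / 5) * Q ^+ 2)); last by apply: ler_wpM2r; lra.
(* For u <= 1/16 the error 8 u P is at most P/2 and the noise still gains P/4; for larger u the
   drift gap between 1 + u and 1 + 100 u / 121 outweighs the error, since P <= 1/2000. *)
rewrite /Q; have [u16|u16] := lerP u (1 / 16).
  apply: (@le_trans _ _ ((1 + u - P / 4) * (1 + u))).
    have uP : u * P <= 1 / 16 * P by apply: ler_wpM2r.
    apply: (@le_trans _ _ ((1 + u - P / 4) * (1 + 100 / 121 * u))).
      by apply: ler_wpM2r; lra.
    by apply: ler_wpM2l; lra.
  have : 0 <= (1 + u) * P * (1 / 16 - u) by rewrite !mulr_ge0//; lra.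
  have : 0 <= (1 + u) * P by rewrite mulr_ge0//; lra.
  by lra.
apply: (@le_trans _ _ ((1 + u) * (1 + 8 * P) * (1 + 100 / 121 * u))).
  by apply: ler_wpM2r; lra.
have -> : (1 - P / 5) * (1 + u) ^+ 2 = (1 + u) * ((1 - P / 5) * (1 + u)) by ring.
rewrite -mulrA; apply: ler_wpM2l; first by lra.
have uP : u * P <= u * (1 / 2000) by apply: ler_wpM2l.
by lra.
Qed.

End Potential.

(** * Drift, noise and persistence in one round *)

Section OneStep.
Variable R : realType.

Lemma balls_cons o x :
  balls (o :: x) = (if o is Some b then nseq 6 b else [::]) ++ balls x.
Proof. by []. Qed.

Lemma count_balls x : count id (balls x) = (6 * count_mem (Some true) x)%N.
Proof.
by elim: x => [|[[]|] x IH] //; rewrite balls_cons count_cat IH [in RHS]/= mulnDr.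
Qed.

Lemma count_balls_negb x : count negb (balls x) = (6 * count_mem (Some false) x)%N.
Proof.
by elim: x => [|[[]|] x IH] //; rewrite balls_cons count_cat IH [in RHS]/= mulnDr.
Qed.

Lemma deltaE x : delta R x = (count_mem (Some true) x)%:R - (count_mem (Some false) x)%:R.
Proof.
rewrite /delta; elim: x => [|[[]|] x IH] /=; rewrite ?big_nil ?subrr// big_cons IH /=;
  rewrite ?natrD; ring.
Qed.

Lemma ndefE x : ndef R x = (count_mem (Some true) x)%:R + (count_mem (Some false) x)%:R.
Proof.
rewrite /ndef; elim: x => [|[[]|] x IH] /=; rewrite ?big_nil ?addr0// big_cons IH /defd /=;
  rewrite ?natrD; ring.
Qed.

Lemma ndef_le_size x : ndef R x <= (size x)%:R.
Proof.
rewrite /ndef; elim: x => [|o x IH]; first by rewrite big_nil.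
by rewrite big_cons /= -nat1r lerD// /defd; case: o; rewrite ?ler01.
Qed.

Lemma size_balls x : (size (balls x))%:R = 6 * ndef R x.
Proof. by rewrite -count_idD count_balls count_balls_negb ndefE natrD !natrM mulrDr. Qed.

Variables (n : nat) (B : {set 'I_n}) (x : seq (option bool)).
Hypothesis n_ge : (1000 <= n)%N.
Hypothesis B_le : #|B|%:R <= 1 / 16 * n%:R :> R.
Hypothesis size_x : size x = n.
Hypothesis x_def : 2 / 3 * n%:R <= ndef R x.

Let n_gt0 : (0 < n)%N. Proof. exact: leq_trans n_ge. Qed.
Let p : R := n%:R^-1.
Let a : R := (count_mem (Some true) x)%:R.
Let b : R := (count_mem (Some false) x)%:R.
Let Q : R := bn p (size (balls x)) (fun m => (2 < m)%N%:R).
Let mu : R := Ex (kern R B x) (delta R).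

Lemma nfree_ge : 15 / 16 * n%:R <= nfree R B.
Proof.
have : #|B|%:R + nfree R B = n%:R :> R by rewrite /nfree -natrD cardsC card_ord.
by move: B_le; lra.
Qed.

Lemma ndef_le_n : ndef R x <= n%:R.
Proof. by rewrite -[in leRHS]size_x ndef_le_size. Qed.

Lemma size_balls_ge (k : nat) : k%:R / 6 * n%:R <= ndef R x -> (k * n <= size (balls x))%N.
Proof. by move=> h; rewrite -(ler_nat R) natrM size_balls; lra. Qed.

Lemma Q_ge : 3 / 4 <= Q.
Proof.
have h : (4 * n <= size (balls x))%N by apply: size_balls_ge; move: x_def; lra.
by rewrite /Q bn_gt2; have := bn_lt3_4n R n_ge h; rewrite -/p; lra.
Qed.

Lemma Q_ge5 : 5 / 6 * n%:R <= ndef R x -> 43 / 50 <= Q.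
Proof.
move=> /size_balls_ge h.
by rewrite /Q bn_gt2; have := bn_lt3_5n R n_ge h; rewrite -/p; lra.
Qed.

Lemma muE : mu * ((6 * (a + b)) * (6 * (a + b) - 1) * (6 * (a + b) - 2)) =
  nfree R B * Q * (6 * (a - b)) * ((6 * (a + b) - 1) * (6 * (a + b) - 2) + 72 * a * b).
Proof.
have := bn_majority p (count id (balls x)) (count negb (balls x)).
rewrite /mu Ex_kern_delta mean_inbox_sg// -/p.
rewrite maj_numE count_idD -/Q ffact3R size_balls ndefE -/a -/b.
rewrite count_balls count_balls_negb !natrM -/a -/b => E.
by rewrite -mulrA E; ring.
Qed.

(** Drawing without replacement only helps: as m <= 36 d^2, (m + 72 a b)/m is at least its limit
    (d^2 + 2 a b)/d^2, and 2 (d^2 + 2 a b) = 3 d^2 - (a - b)^2. *)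
Lemma mu_lower : nfree R B * Q * `|delta R x| * (3 * ndef R x ^+ 2 - delta R x ^+ 2) <=
  `|mu| * (2 * ndef R x ^+ 3).
Proof.
have d1 : 1 <= ndef R x by have := nR_ge R n_ge; move: x_def; lra.
rewrite deltaE ndefE -/a -/b in d1 *.
have a0 : 0 <= a by rewrite ler0n. have b0 : 0 <= b by rewrite ler0n.
set K := nfree R B * Q; set d := a + b in d1 *.
have K0 : 0 <= K by rewrite mulr_ge0 ?ler0n//; have := Q_ge; lra.
set m := (6 * d - 1) * (6 * d - 2).
have m0 : 0 < m by rewrite mulr_gt0; lra.
have m1 : m <= 36 * d ^+ 2 by rewrite /m; nra.
have ab0 : 0 <= a * b by rewrite mulr_ge0.
have E' : mu * d * m = K * (a - b) * (m + 72 * a * b).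
  by have := muE; rewrite -/d -/K /m; lra.
have -> : 3 * d ^+ 2 - (a - b) ^+ 2 = 2 * (d ^+ 2 + 2 * a * b) by rewrite /d; ring.
have E : `|mu| * d * m = K * `|a - b| * (m + 72 * a * b).
  have M0 : 0 <= m + 72 * a * b by lra.
  have d0 : 0 <= d by lra.
  clearbody K d m; have := congr1 (fun z => `|z|) E'; cbv beta.
  by rewrite !(normrM _ m) !(normrM _ d) normrM (normrM K)
     (ger0_norm K0) (gtr0_norm m0) (ger0_norm M0) (ger0_norm d0).
rewrite -(ler_pM2r m0).
have -> : `|mu| * (2 * d ^+ 3) * m = 2 * d ^+ 2 * (`|mu| * d * m) by ring.
have Z0 : 0 <= 2 * (K * `|a - b|) by apply: mulr_ge0 => //; apply: mulr_ge0.
rewrite E.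
have -> : K * `|a - b| * (2 * (d ^+ 2 + 2 * a * b)) * m =
  2 * (K * `|a - b|) * ((d ^+ 2 + 2 * a * b) * m) by ring.
have -> : 2 * d ^+ 2 * (K * `|a - b| * (m + 72 * a * b)) =
  2 * (K * `|a - b|) * (d ^+ 2 * (m + 72 * a * b)) by ring.
apply: ler_wpM2l => //.
have : a * b * m <= a * b * (36 * d ^+ 2) by apply: ler_wpM2l.
lra.
Qed.

Lemma delta_le_ndef : `|delta R x| <= ndef R x.
Proof.
rewrite deltaE ndefE -/a -/b.
by apply: le_trans (ler_normB _ _) _; rewrite !ger0_norm ?ler0n.
Qed.

Lemma mu_ge : 11 / 10 * Num.min `|delta R x| (2 / 5 * n%:R) <= `|mu|.
Proof.
have n1 := nR_ge R n_ge; set Y := Num.min _ _; set y := `|delta R x|; set d := ndef R x.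
have d0 : 0 < d by move: x_def; rewrite -/d; lra.
have Yy : Y <= y by rewrite /Y ge_min lexx.
have Y1 : Y <= 2 / 5 * n%:R by rewrite /Y ge_min lexx orbT.
have Y0 : 0 <= Y by rewrite /Y le_min normr_ge0; lra.
have yd : y <= d := delta_le_ndef.
have K0 : 0 <= nfree R B * Q by rewrite mulr_ge0 ?ler0n//; have := Q_ge; lra.
have KQ : 15 / 16 * n%:R * Q <= nfree R B * Q.
  by apply: ler_wpM2r; [have := Q_ge; lra|exact: nfree_ge].
have N0 : 0 < n%:R :> R by lra.
have d12 : 2 / 3 * n%:R <= d <= n%:R by rewrite x_def ndef_le_n.
have Y01 : 0 <= Y <= 2 / 5 * n%:R by rewrite Y0.
have G := growth_poly N0 d12 Q_ge Q_ge5 KQ Y01.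
have := mu_lower; rewrite -/d -/y -[delta R x ^+ 2]real_normK ?num_real// -/y => L.
have d3 : 0 < 2 * d ^+ 3 by rewrite mulr_gt0 ?exprn_gt0.
rewrite -(ler_pM2r d3); apply: le_trans L.
apply: (@le_trans _ _ (nfree R B * Q * (Y * (3 * d ^+ 2 - Y ^+ 2)))).
  have := ler_wpM2l Y0 G; lra.
rewrite -[leRHS]mulrA; apply: ler_wpM2l => //.
rewrite -subr_ge0.
(* The map y (3 d^2 - y^2) increases on [0, d], so [y] may be lowered to the truncated [Y]. *)
have -> : y * (3 * d ^+ 2 - y ^+ 2) - Y * (3 * d ^+ 2 - Y ^+ 2) =
  (y - Y) * ((d ^+ 2 - y ^+ 2) + (d ^+ 2 - y * Y) + (d ^+ 2 - Y ^+ 2)) by ring.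
apply: mulr_ge0; first by lra.
have : y ^+ 2 <= d ^+ 2 by rewrite lerXn2r ?nnegrE//; lra.
have : Y ^+ 2 <= d ^+ 2 by rewrite lerXn2r ?nnegrE//; lra.
have : y * Y <= d ^+ 2 by rewrite expr2 ler_pM//; lra.
lra.
Qed.

(** Chebyshev: the mean is at least 45n/64, which exceeds 2n/3 by 7n/192 > n/32, and the variance is
    at most 96n. *)
Lemma ndef_fail :
  Ex (kern R B x) (fun y => (ndef R y < 2 / 3 * n%:R)%R%:R) <= 96 * 32 ^+ 2 / n%:R.
Proof.
have n1 := nR_ge R n_ge; have N0 : 0 < n%:R :> R by lra.
set m := nfree R B * Q.
have m1 : 45 / 64 * n%:R <= m.
  have := ler_wpM2r (_ : 0 <= Q) nfree_ge; have := Q_ge; rewrite -/m => q1 h.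
  apply: le_trans (h _); last by lra.
  by have := ler_wpM2l (_ : 0 <= 15 / 16 * n%:R) q1; move=> h'; apply: le_trans (h' _); lra.
apply: (@le_trans _ _ (Ex (kern R B x) (fun y => (32 / n%:R) ^+ 2 * (ndef R y - m) ^+ 2))).
  apply: ler_Ex => [|y]; first exact: isprob_kern.
  case: ltP => [h|_] /=; last by rewrite -exprMn sqr_ge0.
  rewrite -exprMn -sqrrN -[leLHS](expr1n _ 2) lerXn2r ?nnegrE ?ler01//.
    by rewrite -mulrN mulr_ge0 ?divr_ge0//; lra.
  by rewrite -mulrN mulrAC ler_pdivlMr// mul1r; lra.
rewrite (ExZ _ ((32 / n%:R) ^+ 2) (fun y => (ndef R y - m) ^+ 2)).
have V := kern_ndef_variance R n_gt0 B x; rewrite -/p -/Q -/m size_balls in V.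
apply: le_trans (ler_wpM2l (sqr_ge0 _) V) _.
have d1 := ndef_le_n.
have -> : 96 * 32 ^+ 2 / n%:R = (32 / n%:R) ^+ 2 * (96 * n%:R) :> R.
  by field; rewrite gt_eqF.
by apply: ler_wpM2l; [exact: sqr_ge0|lra].
Qed.

Lemma sum_le_6n : (count id (balls x) + count negb (balls x) <= 6 * n)%N.
Proof. by rewrite count_idD -(ler_nat R) size_balls natrM; have := ndef_le_n; lra. Qed.

(** If ndef >= 2n/3 and |delta| < 2n/5, each value is held by at least 2n/15 nodes, which send 4n/5
    balls. *)
Lemma bin_point_ge (A : nat) : 4 / 5 * n%:R <= A%:R :> R ->
  3 / 10 * (1 - p) ^+ (A - 2) <= bn p A (fun i => (i == 2)%N%:R).
Proof.
move=> hA; have pb := p_bounds R n_ge; rewrite -/p in pb.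
have np := np1 R n_ge; rewrite -/p in np.
rewrite bn_point bin2R ffact2R; apply: ler_wpM2r; first by rewrite exprn_ge0//; lra.
have Ap : 4 / 5 <= A%:R * p.
  have p0 : 0 <= p by lra.
  have h : 4 / 5 * n%:R * p <= A%:R * p by exact: ler_wpM2r.
  by apply: le_trans h; rewrite -mulrA np mulr1.
have -> : A%:R * (A%:R - 1) / 2 * p ^+ 2 = (A%:R * p) * (A%:R * p - p) / 2 by field.
have : 4 / 5 * (4 / 5 - 1 / 1000) <= (A%:R * p) * (A%:R * p - p) by rewrite ler_pM//; lra.
lra.
Qed.

Lemma delta_variance_ge : `|delta R x| < 2 / 5 * n%:R ->
  expR (-12) / 20 * n%:R <= Ex (kern R B x) (fun y => (delta R y - mu) ^+ 2).
Proof.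
move=> dl; apply: le_trans (kern_delta_sqr_ge R n_gt0 B x); rewrite -/p.
set cA := count id (balls x); set cB := count negb (balls x).
have -> : bn p cA (fun i => bn p cB (fun j => (i == 2)%N%:R * (j == 2)%N%:R)) =
   bn p cB (fun j => (j == 2)%N%:R) * bn p cA (fun i => (i == 2)%N%:R).
  by rewrite -bnZ; apply: eq_bn => i; rewrite bnZ mulrC.
have n1 := nR_ge R n_ge.
move: dl; rewrite ltr_norml deltaE -/a -/b => dl.
have ab := x_def; rewrite ndefE -/a -/b in ab.
have hA : 3 / 10 * (1 - p) ^+ (cA - 2) <= bn p cA (fun i => (i == 2)%N%:R).
  by apply: bin_point_ge; rewrite /cA count_balls natrM -/a; lra.
have hB : 3 / 10 * (1 - p) ^+ (cB - 2) <= bn p cB (fun i => (i == 2)%N%:R).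
  by apply: bin_point_ge; rewrite /cB count_balls_negb natrM -/b; lra.
have pb := p_bounds R n_ge; rewrite -/p in pb.
have E : expR (-12) <= (1 - p) ^+ (cB - 2) * (1 - p) ^+ (cA - 2).
  apply: le_trans (pow_6n_ge R n_ge) _; rewrite -/p -exprD ler_wiXn2l//; [lra|lra|].
  apply: leq_trans sum_le_6n; rewrite addnC -/cA -/cB.
  by apply: leq_add; exact: leq_subr.
have e0 := expR_gt0 (-12 : R).
have X0 k : 0 <= 3 / 10 * (1 - p) ^+ k by rewrite mulr_ge0// ?exprn_ge0; lra.
have H := ler_pM (X0 _) (X0 _) hB hA.
(* The constant 1/20 is a rounding down of (15/16)(3/10)^2. *)
have := ler_pM (_ : 0 <= 15 / 16 * n%:R) (_ : 0 <= 9 / 100 * expR (-12)) nfree_ge (_ : 9 / 100 * expR (-12) <= _).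
move=> K; apply: le_trans (K _ _ _ _); first by nra.
- lra.
- lra.
- by apply: le_trans H; lra.
Qed.

Lemma delta_fourth_le : Ex (kern R B x) (fun y => (delta R y - mu) ^+ 4) <=
  (512 + 8192 * 36) * n%:R ^+ 2.
Proof.
apply: le_trans (kern_delta_fourth R n_gt0 B x) _; rewrite size_balls.
have -> : (512 + 8192 * 36) * n%:R ^+ 2 = 512 * n%:R ^+ 2 + 8192 * 36 * n%:R ^+ 2 :> R by ring.
have : ndef R x ^+ 2 <= n%:R ^+ 2.
  have d0 : 0 <= ndef R x by have := nR_ge R n_ge; move: x_def; lra.
  by rewrite lerXn2r ?nnegrE ?ler0n ?ndef_le_n.
move=> h; rewrite lerD2l exprMn mulrA.
have -> : 8192 * 6 ^+ 2 = 8192 * 36 :> R by ring.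
by apply: ler_wpM2l => //; rewrite mulr_ge0.
Qed.

Lemma delta_variance_le :
  Ex (kern R B x) (fun y => (delta R y - mu) ^+ 2) <= 97 * n%:R.
Proof.
apply: le_trans (kern_delta_sqr_le R n_gt0 B x) _; rewrite size_balls.
by have := ndef_le_n; lra.
Qed.

(** Here |mu| >= (11/10)(2n/5) = 11n/25, so falling below 2n/5 takes a deviation of at least
    n/25. *)
Lemma delta_stays : 2 / 5 * n%:R <= `|delta R x| ->
  Ex (kern R B x) (fun y => (`|delta R y| < 2 / 5 * n%:R)%R%:R) <=
  25 ^+ 4 * (512 + 8192 * 36) / n%:R ^+ 2.
Proof.
move=> dl; have n1 := nR_ge R n_ge; have N0 : 0 < n%:R :> R by lra.
have := mu_ge; rewrite (min_r dl) => m1.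
apply: (@le_trans _ _ (Ex (kern R B x) (fun y => (25 / n%:R) ^+ 4 * (delta R y - mu) ^+ 4))).
  apply: ler_Ex => [|y]; first exact: isprob_kern.
  have e4 (z : R) : 0 <= z ^+ 4 by rewrite (exprM z 2 2) sqr_ge0.
  case: ltP => [h|_] /=; last by rewrite mulr_ge0.
  rewrite -exprMn.
  have h1 : 1 <= `|25 / n%:R * (delta R y - mu)|.
    rewrite normrM ger0_norm ?divr_ge0// mulrAC ler_pdivlMr// mul1r.
    by have := lerB_dist mu (delta R y); rewrite distrC; lra.
  have -> : (25 / n%:R * (delta R y - mu)) ^+ 4 = `|25 / n%:R * (delta R y - mu)| ^+ 4.
    by rewrite -normrX ger0_norm.
  by rewrite exprn_ege1.
rewrite (ExZ _ ((25 / n%:R) ^+ 4) (fun y => (delta R y - mu) ^+ 4)).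
have -> : 25 ^+ 4 * (512 + 8192 * 36) / n%:R ^+ 2 =
   (25 / n%:R) ^+ 4 * ((512 + 8192 * 36) * n%:R ^+ 2) :> R.
  move: (512 + _) => c; field; rewrite gt_eqF//.
apply: ler_wpM2l; last exact: delta_fourth_le.
by rewrite exprn_ge0// divr_ge0.
Qed.

End OneStep.

(** * Iteration over the rounds *)

Section Rounds.
Variable R : realType.

Definition fourth_cst : R := 512 + 8192 * 36.
Definition noise : R := expR (-12) / 20.
(** Chosen so that the fourth moment hypothesis of [potential_step] holds:
    [slope * fourth_cst = noise / 8]. *)
Definition slope : R := noise / (8 * fourth_cst).
Definition rate : R := 1 - slope * noise / 5.

Lemma fourth_cst_ge : 512 <= fourth_cst.
Proof. by rewrite lerDl mulr_ge0. Qed.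

Lemma noise_bounds : 0 < noise <= 1 / 200.
Proof.
have e0 := expR_gt0 (-12 : R).
have e1 : expR (-12) <= 1 / 10 :> R.
  rewrite expRN -div1r ler_pdivrMr ?expR_gt0//.
  by have := expR_ge1Dx (12 : R); lra.
by rewrite /noise divr_gt0//=; lra.
Qed.

Lemma slope_bounds : 0 < slope <= 1 / 200 / 1000.
Proof.
have c4 := fourth_cst_ge; have v := noise_bounds.
rewrite /slope divr_gt0 /=; [|lra|lra].
rewrite ler_pdivrMr; last lra.
by lra.
Qed.

Lemma slope_fourth : slope * fourth_cst = noise / 8.
Proof. by rewrite /slope; field; have := fourth_cst_ge; lra. Qed.

Lemma rate_bounds : 0 <= rate <= 1.
Proof.
have v := noise_bounds; have s := slope_bounds.
have h : 0 <= slope * noise by rewrite mulr_ge0; lra.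
have h' : slope * noise <= 1 * 1 by rewrite ler_pM; lra.
by rewrite /rate; lra.
Qed.

Section FixedSize.
Variable n : nat.
Hypothesis n_ge : (1000 <= n)%N.
Let N : R := n%:R.
Let n_gt0 : (0 < n)%N. Proof. exact: leq_trans n_ge. Qed.

Lemma N_ge : 1000 <= N. Proof. exact: nR_ge. Qed.

Definition pot (x : seq (option bool)) : R :=
  (1 + slope / N * delta R x ^+ 2)^-1.

(** Cut to 0 past the threshold: drift beyond it is not controlled, and a return below it is charged
    to [err4]. *)
Definition tpot (x : seq (option bool)) : R := (`|delta R x| < 2 / 5 * N)%R%:R * pot x.

Definition err4 : R := 25 ^+ 4 * fourth_cst / N ^+ 2.
Definition err2 : R := 96 * 32 ^+ 2 / N.

(** Inverse of the potential at |delta| = 2n/5, the Markov factor that makes [scale * tpot] at least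
    1 below the threshold. *)
Definition scale : R := 1 + slope * (4 / 25) * N.

(** Bounds the failure probability with [T] rounds left. Falling back costs [scale * err4] per
    round, losing defined nodes costs [err2], and the last indicator makes the bound trivial when
    too few nodes are defined. *)
Definition fail_bound (T : nat) (x : seq (option bool)) : R :=
  scale * (rate ^+ T * tpot x + T%:R * err4) + T%:R * err2 + (ndef R x < 2 / 3 * N)%R%:R.

Lemma pot_ge0 x : 0 <= pot x.
Proof.
have s := slope_bounds; have N1 := N_ge.
by rewrite /pot invr_ge0 addr_ge0// mulr_ge0 ?sqr_ge0// divr_ge0; lra.
Qed.

Lemma pot_le1 x : pot x <= 1.
Proof.
have s := slope_bounds; have N1 := N_ge.
rewrite /pot invf_le1; last first.
  by rewrite ltr_pwDl// mulr_ge0 ?sqr_ge0// divr_ge0; lra.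
by rewrite lerDl mulr_ge0 ?sqr_ge0// divr_ge0; lra.
Qed.

Lemma err4_ge0 : 0 <= err4.
Proof. by have := fourth_cst_ge; rewrite /err4 => h; rewrite divr_ge0 ?mulr_ge0 ?sqr_ge0//; lra. Qed.

Lemma err2_ge0 : 0 <= err2.
Proof. by have := N_ge; rewrite /err2 => h; rewrite divr_ge0 ?mulr_ge0 ?sqr_ge0//; lra. Qed.

Lemma scale_ge1 : 1 <= scale.
Proof.
by have := N_ge; have := slope_bounds => s N1; rewrite lerDl mulr_ge0//; lra.
Qed.

Lemma pot_contract (B : {set 'I_n}) x : #|B|%:R <= 1 / 16 * N -> size x = n ->
  2 / 3 * N <= ndef R x -> `|delta R x| < 2 / 5 * N ->
  Ex (kern R B x) pot <= rate * pot x.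
Proof.
move=> hB sx dx dl; have N1 := N_ge; have N0 : 0 < N by lra.
have s := slope_bounds; have v := noise_bounds.
have Vge := delta_variance_ge n_ge hB sx dx dl; have Vle := delta_variance_le R B n_ge sx.
have Wle := delta_fourth_le B n_ge sx dx; have mg := mu_ge n_ge hB sx dx.
rewrite (min_l (ltW dl)) in mg.
rewrite /pot /rate -/noise -/fourth_cst -/N in Vge Vle Wle *.
have e0 : 0 < slope / N by rewrite divr_gt0//; lra.
set mu := Ex (kern R B x) (delta R) in Vge Vle Wle mg *.
have eV : slope * noise <= slope / N * Ex (kern R B x) (fun y => (delta R y - mu) ^+ 2).
  have -> : slope * noise = slope / N * (noise * N) by field; rewrite gt_eqF.
  by rewrite ler_pM2l.
apply: (@potential_step R _ _ (delta R) mu) => //.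
- exact: isprob_kern.
- exact: ltW.
- by rewrite mulr_ge0; lra.
(* Here 97 slope <= 97/200000 < 1/2000, which is why [slope_bounds] is so small. *)
- apply: le_trans (_ : slope / N * (97 * N) <= _); first by rewrite ler_pM2l.
  have -> : slope / N * (97 * N) = 97 * slope by field; rewrite gt_eqF.
  by lra.
- apply: le_trans (_ : (slope / N) ^+ 2 * (fourth_cst * N ^+ 2) <= _).
    by apply: ler_wpM2l Wle; exact: sqr_ge0.
  have -> : (slope / N) ^+ 2 * (fourth_cst * N ^+ 2) = slope * (slope * fourth_cst).
    by field; rewrite gt_eqF.
  rewrite slope_fourth; lra.
- rewrite -[delta R x ^+ 2]real_normK ?num_real// -[mu ^+ 2]real_normK ?num_real//.
  have -> : 121 / 100 * `|delta R x| ^+ 2 = (11 / 10 * `|delta R x|) ^+ 2 by field.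
  by rewrite lerXn2r ?nnegrE//; have := normr_ge0 (delta R x); lra.
Qed.

Lemma tpot_contract (B : {set 'I_n}) x : #|B|%:R <= 1 / 16 * N -> size x = n ->
  2 / 3 * N <= ndef R x -> Ex (kern R B x) tpot <= rate * tpot x + err4.
Proof.
move=> hB sx dx; have e4 := err4_ge0; have kp := isprob_kern R n_gt0 B x.
rewrite {2}/tpot; case: (ltP `|delta R x| (2 / 5 * N)) => [dl|dl] /=.
  rewrite mul1r; apply: le_trans (_ : rate * pot x <= _); last by lra.
  apply: le_trans (pot_contract hB sx dx dl); apply: ler_Ex => // y.
  by rewrite /tpot; case: (_ < _) => /=; rewrite ?mul1r// mul0r pot_ge0.
rewrite mul0r mulr0 add0r; apply: le_trans (delta_stays n_ge hB sx dx dl).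
apply: ler_Ex => // y; rewrite /tpot -/N; case: (_ < _) => /=; rewrite ?mul0r//.
by rewrite mul1r pot_le1.
Qed.

Lemma fail_bound_step (B : {set 'I_n}) T x : #|B|%:R <= 1 / 16 * N -> size x = n ->
  2 / 3 * N <= ndef R x -> Ex (kern R B x) (fail_bound T) <= fail_bound T.+1 x.
Proof.
move=> hB sx dx; have kp := isprob_kern R n_gt0 B x.
have S1 := scale_ge1; have r01 := rate_bounds; have e4 := err4_ge0.
have c := tpot_contract hB sx dx.
have f : Ex (kern R B x) (fun y => (ndef R y < 2 / 3 * N)%R%:R) <= err2 := ndef_fail n_ge hB sx dx.
have -> : Ex (kern R B x) (fail_bound T) = scale * (rate ^+ T * Ex (kern R B x) tpot + T%:R * err4)
   + T%:R * err2 + Ex (kern R B x) (fun y => (ndef R y < 2 / 3 * N)%R%:R).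
  by rewrite /fail_bound !ExD ExZ ExD ExZ !Ex_cst.
rewrite /fail_bound ltNge dx /= addr0 -[T.+1%:R]natr1.
have rT0 : 0 <= rate ^+ T by rewrite exprn_ge0//; lra.
have rT1 : rate ^+ T <= 1 by rewrite exprn_ile1//; lra.
have h1 : rate ^+ T * Ex (kern R B x) tpot <= rate ^+ T.+1 * tpot x + err4.
  apply: le_trans (ler_wpM2l rT0 c) _; rewrite mulrDr exprSr mulrA lerD2l.
  by rewrite ler_piMl.
have := ler_wpM2l (_ : 0 <= scale) (lerD h1 (lexx (T%:R * err4))).
by move=> h2; have := h2 (le_trans ler01 S1); lra.
Qed.

Definition agree (x : seq (option bool)) : bool :=
  [exists b : bool, (1 - 7 / 15) * N <= (count_mem (Some b) x)%:R].

Lemma almost_agreeE (c : config n) x : size x = n -> (forall u : 'I_n, c.1 u = nth None x u) ->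
  almost_agree (7 / 15 : R) c = agree x.
Proof.
move=> sx cx; apply: eq_existsb => b; congr (_ <= _%:R).
rewrite -sum1dep_card -sum1_count (big_nth None) sx big_mkord.
by apply: eq_bigl => u; rewrite cx.
Qed.

(** The Markov step: without agreement either too few nodes are defined or |delta| < 2n/5, for
    otherwise one value has (2/3 + 2/5) n / 2 = 8n/15 nodes. *)
Lemma fail_bound0 x : (~~ agree x)%:R <= fail_bound 0 x.
Proof.
have S1 := scale_ge1; have N1 := N_ge; have N0 : 0 < N by lra.
rewrite /fail_bound expr0 !mul0r !addr0 mul1r.
have t0 : 0 <= tpot x by rewrite /tpot mulr_ge0 ?pot_ge0.
have st0 : 0 <= scale * tpot x by rewrite mulr_ge0//; lra.
have [ag|nag] := boolP (agree x) => /=; first by rewrite addr_ge0.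
case: (ltP (ndef R x) (2 / 3 * N)) => [_|dx] /=; first by lra.
rewrite addr0 /tpot; case: (ltP `|delta R x| (2 / 5 * N)) => [dl|dl] /=.
  have sl := slope_bounds; have e0 : 0 <= slope / N by rewrite divr_ge0; lra.
  have d2 : delta R x ^+ 2 <= (2 / 5 * N) ^+ 2.
    by rewrite -[leLHS]real_normK ?num_real// lerXn2r ?nnegrE//; lra.
  have h := ler_wpM2l e0 d2.
  have h' : slope / N * (2 / 5 * N) ^+ 2 = slope * (4 / 25) * N by field; rewrite gt_eqF.
  have z0 : 0 <= slope / N * delta R x ^+ 2 by rewrite mulr_ge0 ?sqr_ge0.
  rewrite mul1r /pot ler_pdivlMr ?mul1r /scale; lra.
case/negP: nag; apply/existsP; move: dx dl; rewrite ndefE deltaE => dx.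
by rewrite ler_normr => /orP[dl|dl]; [exists true|exists false]; lra.
Qed.

Lemma fail_bound_main_ge0 T x : 0 <= scale * (rate ^+ T * tpot x + T%:R * err4) + T%:R * err2.
Proof.
have S1 := scale_ge1; have r01 := rate_bounds.
have t0 : 0 <= tpot x by rewrite /tpot mulr_ge0 ?pot_ge0.
have h1 : 0 <= rate ^+ T * tpot x by rewrite mulr_ge0 ?exprn_ge0//; lra.
have h2 : 0 <= T%:R * err4 by rewrite mulr_ge0 ?err4_ge0.
have h3 : 0 <= T%:R * err2 by rewrite mulr_ge0 ?err2_ge0.
have h4 : 0 <= scale * (rate ^+ T * tpot x + T%:R * err4) by rewrite mulr_ge0//; lra.
lra.
Qed.

(** Total mass one is what the passage to the complementary event in [process_success] takes. *)
Lemma Ex_run1 (adv : adversary n) T h c : Ex (run R 6 3 adv T h c) (fun=> 1) = 1.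
Proof.
elim: T h c => [|T IH] h c; first exact: Ex_ret.
rewrite [run _ _ _ _ _ _ _]/= Ex_bind; under eq_Ex do rewrite IH.
rewrite Ex_round; under eq_Ex => x do rewrite (Ex_cst 1 (isprob_send R n_gt0 x)).
exact/Ex_cst/isprob_upd.
Qed.

(* The inboxes of a round are drawn after adv h is fixed, so sending and updating
   combine into kern; the cap at 1 covers the states with too few defined nodes. *)
Lemma run_fail (adv : adversary n) T h x :
  (forall h, #|adv h|%:R <= 1 / 16 * N) -> size x = n ->
  Ex (send R n x) (fun c => Ex (run R 6 3 adv T h c) (fun c' => (~~ almost_agree (7 / 15 : R) c')%:R))
  <= Num.min 1 (fail_bound T x).
Proof.
move=> hadv; elim: T h x => [|T IH] h x sx.
  rewrite (@Ex_send_val R n n_gt0 x _ (~~ agree x)%:R)//.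
    by rewrite le_min fail_bound0 andbT; case: (agree x); rewrite ?ler01.
  by move=> c cx; rewrite Ex_ret (almost_agreeE sx cx).
apply: (@le_trans _ _ (Ex (kern R (adv h) x) (fun y => Num.min 1 (fail_bound T y)))).
  rewrite -Ex_send_upd//; apply: ler_Ex => [|c]; first exact: isprob_send.
  rewrite [run _ _ _ _ _ _ _]/= Ex_bind Ex_round; apply: ler_Ex_dseq => [u|y].
    exact: isprob_vdist.
  by rewrite -cardE card_ord => sy; apply: IH.
have kp := isprob_kern R n_gt0 (adv h) x.
rewrite le_min Ex_le//=; last by move=> y; rewrite ge_min lexx.
case: (ltP (ndef R x) (2 / 3 * N)) => [dx|dx].
  apply: (@le_trans _ _ 1); first by apply: Ex_le => // y; rewrite ge_min lexx.
  by rewrite /fail_bound dx lerDr fail_bound_main_ge0.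
apply: le_trans (fail_bound_step T (hadv h) sx dx).
by apply: ler_Ex => // y; rewrite ge_min lexx orbT.
Qed.

Lemma process_success (adv : adversary n) x0 T :
  (forall h, #|adv h|%:R <= 1 / 16 * N) ->
  1 - (scale * (rate ^+ T + T%:R * err4) + T%:R * err2) <=
  prob (process R 6 3 adv x0 T) (almost_agree (7 / 15 : R)).
Proof.
move=> hadv; set xs := [seq Some (x0 u) | u <- enum 'I_n].
have sx : size xs = n by rewrite size_map -cardE card_ord.
have dx : ndef R xs = N.
  rewrite /ndef big_map; under eq_bigr do rewrite /defd /=.
  by rewrite big_enum /= sumr_const card_ord.
have N1 := N_ge.
have := run_fail T [::] hadv sx; rewrite le_min => /andP[_].
rewrite /fail_bound dx ltNge (_ : 2 / 3 * N <= N) /= ?addr0; last by lra.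
rewrite prob_Ex /process Ex_bind Ex_init => h.
have -> : Ex (send R n xs) (fun c => Ex (run R 6 3 adv T [::] c) (fun a => (almost_agree (7 / 15 : R) a)%:R))
  = 1 - Ex (send R n xs) (fun c => Ex (run R 6 3 adv T [::] c) (fun c' => (~~ almost_agree (7 / 15 : R) c')%:R)).
  rewrite -[X in X - _](Ex_cst 1 (isprob_send R n_gt0 xs)) -ExN -ExD.
  apply: eq_Ex => c; rewrite -[X in X - _](Ex_run1 adv T [::] c) -ExN -ExD.
  by apply: eq_Ex => c'; case: almost_agree; rewrite /= ?subr0 ?subrr.
rewrite lerD2l lerN2; apply: le_trans h _; rewrite lerD2r.
apply: ler_wpM2l; first by have := scale_ge1; lra.
rewrite lerD2r ler_piMr//; first by rewrite exprn_ge0//; have := rate_bounds; lra.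
by rewrite /tpot; case: (_ < _); rewrite ?mul1r ?mul0r ?ler01 ?pot_le1.
Qed.

End FixedSize.
End Rounds.

(** * Asymptotics and conclusion *)

(** Since 1 - t <= exp(-t), the constant 10 yields exp(-2 ln n); the power -2 leaves 1/n after
    multiplication by [scale]. *)
Lemma rate_pow_le (R : realType) (n T : nat) : (0 < n)%N ->
  10 / (slope R * noise R) * ln n%:R <= T%:R -> rate R ^+ T <= n%:R ^- 2.
Proof.
move=> n0 hT; set al := slope R * noise R in hT *.
have al0 : 0 < al.
  by rewrite mulr_gt0//; [have := slope_bounds R|have := noise_bounds R]; lra.
have r01 := rate_bounds R.
apply: (@le_trans _ _ (expR (- (al / 5)) ^+ T)).
  rewrite lerXn2r ?nnegrE ?expR_ge0//; first by lra.
  by apply: le_trans (expR_ge1Dx _); rewrite /rate -/al.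
have nK : expR (ln n%:R) = n%:R :> R by rewrite lnK// posrE ltr0n.
rewrite -expRM_natl -[in leRHS]nK -exprVn -expRN -expRM_natl ler_expR.
have := ler_wpM2l (ltW al0) hT.
have -> : al * (10 / al * ln n%:R) = 10 * ln n%:R :> R by field; rewrite gt_eqF.
lra.
Qed.

(** Here s = n^(1/4). The failure is O(T/n), and ln n <= 4 s makes T = O(s), so the total is
    O(s^(-3)); the lower bound on [s] absorbs the constant. *)
Lemma fail_asymptotics (R : realType) (s K T c4 c2 r sc lnN : R) :
  0 <= K -> 0 <= c4 -> 0 <= c2 -> 0 <= T -> 0 <= r -> 0 <= sc ->
  2 + (4 * K + 1) * (2 * c4 + c2) <= s -> T <= K * lnN + 1 -> lnN <= 4 * s ->
  r <= (s ^+ 4) ^- 2 -> sc <= 2 * s ^+ 4 ->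
  sc * (r + T * (c4 / (s ^+ 4) ^+ 2)) + T * (c2 / s ^+ 4) <= s^-1.
Proof.
move=> K0 c40 c20 T0 r0 sc0 cs TK lns rs scs.
have c0 : 0 <= 2 * c4 + c2 by lra.
have Kc : 0 <= (4 * K + 1) * (2 * c4 + c2) by rewrite mulr_ge0//; lra.
have s1 : 1 < s by lra.
have s0 : 0 < s by lra.
have s40 : 0 < s ^+ 4 by rewrite exprn_gt0.
have Ts : T <= (4 * K + 1) * s by have := ler_wpM2l K0 lns; lra.
apply: (@le_trans _ _ ((2 + T * (2 * c4 + c2)) / s ^+ 4)).
  apply: (@le_trans _ _ (2 * s ^+ 4 * ((s ^+ 4) ^- 2 + T * (c4 / (s ^+ 4) ^+ 2)) + T * (c2 / s ^+ 4))).
    rewrite lerD2r ler_pM// ?lerD2r//.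
    by rewrite addr_ge0// mulr_ge0// divr_ge0// sqr_ge0.
  by rewrite le_eqVlt; apply/orP; left; apply/eqP; field; rewrite gt_eqF.
rewrite ler_pdivrMr// (exprS s 3) mulKf ?gt_eqF//.
have h := ler_wpM2r c0 Ts.
apply: (@le_trans _ _ (s * s)); last by rewrite -expr2 ler_eXn2l.
apply: (@le_trans _ _ ((2 + (4 * K + 1) * (2 * c4 + c2)) * s)); last by rewrite ler_pM2r.
lra.
Qed.

Theorem theorem1 (R : realType) (eps : R) :
  eps <= 1 / 16 ->
  exists (gamma C c : R) (n0 : nat),
    0 <= gamma < 1 / 2 /\ 0 < C /\ 0 < c /\
    forall n : nat, (n0 <= n)%N ->
      exists T : nat, (T%:R : R) <= C * ln (n%:R : R) /\
        forall (x0 : 'I_n -> bool) (adv : adversary n),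
          @eps_bounded R n eps adv ->
          1 - (n%:R : R) `^ (- c) <= prob (@process R n 6 3 adv x0 T) (@almost_agree R n gamma).
Proof.
move=> eps_le.
have sl0 : 0 < slope R by case/andP: (slope_bounds R).
have al0 : 0 < slope R * noise R by rewrite mulr_gt0//; case/andP: (noise_bounds R).
pose K : R := 10 / (slope R * noise R); have K0 : 0 < K by rewrite divr_gt0.
pose c4 : R := 25 ^+ 4 * fourth_cst R; pose c2 : R := 96 * 32 ^+ 2.
have c40 : 0 <= c4 by rewrite mulr_ge0 ?exprn_ge0// (le_trans _ (fourth_cst_ge R)).
have c20 : 0 <= c2 by rewrite mulr_ge0 ?exprn_ge0.
pose cst : R := 2 + (4 * K + 1) * (2 * c4 + c2).
have cst0 : 0 <= cst.
  apply: addr_ge0 => //; apply: mulr_ge0; last by apply: addr_ge0 => //; apply: mulr_ge0.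
  by apply: addr_ge0 => //; apply: mulr_ge0 => //; apply: ltW.
have ln2 : 0 < ln (2 : R) by rewrite ln_gt0// ltr1n.
(* The term 1/ln 2 pays for rounding T up, as ln n >= ln 2; n >= cst^4 gives cst <= n^(1/4), which
   [fail_asymptotics] asks for. *)
exists (7 / 15), (K + (ln 2)^-1), (1 / 4), (maxn 1000 (Num.truncn (cst ^+ 4)).+1).
split; first by clear; lra.
split; first by rewrite addr_gt0 ?invr_gt0.
split; first by clear; lra.
move=> n; rewrite geq_max => /andP[n_ge n_cst].
have n0 : (0 < n)%N by apply: leq_trans n_ge.
have N0 : 0 < n%:R :> R by rewrite ltr0n.
have lnN : ln (2 : R) <= ln n%:R.
  by rewrite ler_ln ?posrE// ler_nat (leq_trans _ n_ge).
exists (Num.truncn (K * ln n%:R)).+1; set T := (Num.truncn _).+1.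
have Kln : 0 <= K * ln n%:R by rewrite mulr_ge0 ?(ltW K0)// (le_trans (ltW ln2)).
have T_ge : K * ln n%:R <= T%:R by apply/ltW/truncnS_gt.
have T_le : T%:R <= K * ln n%:R + 1 by rewrite -natr1 lerD2r truncn_le.
split.
  apply: le_trans T_le _; rewrite mulrDl lerD2l mulrC ler_pdivlMr// mul1r.
  exact: lnN.
move=> x0 adv adv_le.
have hadv h : #|adv h|%:R <= 1 / 16 * n%:R :> R.
  by apply: le_trans (adv_le h) _; rewrite ler_pM2r.
apply: le_trans (process_success n_ge x0 T hadv); rewrite lerD2l lerN2.
have rT : rate R ^+ T <= n%:R ^- 2 by apply: rate_pow_le.
have sc : scale R n <= 2 * n%:R.
  have -> : 2 * n%:R = n%:R + n%:R :> R by rewrite mulr_natl mulr2n.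
  apply: lerD; first by rewrite ler1n.
  apply: ler_piMl; first exact: ltW.
  by case/andP: (slope_bounds R) => _ h; move: h; clear; lra.
rewrite powRN; set s : R := n%:R `^ (1 / 4).
have s4 : s ^+ 4 = n%:R.
  rewrite -powR_mulrn ?powR_ge0// -powRrM.
  have -> : 1 / 4 * 4 = 1 :> R by clear; field.
  by rewrite powRr1.
have s0 : 0 < s by rewrite powR_gt0.
have scst : cst <= s.
  rewrite -(@ler_pXn2r _ 4) ?nnegrE ?(ltW s0)// s4.
  by apply/ltW/(lt_le_trans (truncnS_gt _)); rewrite ler_nat.
have lns : ln n%:R <= 4 * s.
  by rewrite -s4 lnXn// -[leLHS]mulr_natl ler_pM2l// ltW// ln_sublinear.
rewrite /err4 /err2 -/c4 -/c2 -s4.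
apply: (@fail_asymptotics R s K _ _ _ _ _ (ln n%:R)) => //.
- exact: ltW.
- by rewrite exprn_ge0//; case/andP: (rate_bounds R).
- by rewrite (le_trans ler01)// scale_ge1.
- by rewrite s4.
- by rewrite s4.
Qed.
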